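(* Let $\Theta$ be a program, let $\mathcal{T}$ be a type name declared in $\Theta$, and let $\mathcal{X}_{\mathcal{T}}(\Theta)$ denote the defunctionalization $\mathcal{D}_{\mathcal{T}}(\Theta)$ if $\mathcal{T}$ is declared as a codata type in $\Theta$, and the refunctionalization $\mathcal{R}_{\mathcal{T}}(\Theta)$ if $\mathcal{T}$ is declared as a data type in $\Theta$. If $\Theta$ is well-formed (every declaration $\delta$ of $\Theta$ satisfies $\vdash_\Theta\delta\ \mathrm{OK}$), then $\mathcal{X}_{\mathcal{T}}(\Theta)$ is well-formed (every declaration $\delta$ of $\mathcal{X}_{\mathcal{T}}(\Theta)$ satisfies $\vdash_{\mathcal{X}_{\mathcal{T}}(\Theta)}\delta\ \mathrm{OK}$).
   Context: **Syntax.** Fix disjoint sets of type names $\mathcal T$, producer names $\mathrm C$, consumer names $\mathrm d$ and variables $x,z,\dots$. Expressions: $e,s,t ::= x\mid \mathrm{Type}\mid \mathcal T\rho\mid \mathrm C\sigma\mid e.\mathrm d\sigma$. Substitutions: $\rho,\sigma ::= ()\mid(e,\sigma)$. Contexts: $\Gamma::=\emptyset\mid\Gamma,x:t$. Telescopes: $\Xi,\Psi::=\emptyset\mid x:t,\Xi$ (later types may mention earlier variables; a closed telescope may be used as a context; $\Xi_1;\Xi_2$ is concatenation). Everything is taken up to renaming of bound variables, with distinct telescopes using distinct variables. $[\sigma/\Xi]$ replaces the variables of $\Xi$ by the components of $\sigma$; $\mathrm{id}_\Xi$ is the tuple of variables of $\Xi$. A program $\Theta$ is a finite list of mutually recursive,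 well-scoped declarations, each of one of the forms: - data type: $\mathbf{data}\ \mathcal T\Psi\{\overline{\mathrm C\,\Xi:\mathcal T\rho}\}$, introducing the type name $\mathcal T$ and constructors $\mathrm C$ ($\rho$ in scope of $\Xi$); - definition: $\mathbf{def}\ (z:\mathcal T\rho).\mathrm d\,\Xi:t\{\overline a\}$, with $\mathcal T$ a data type, $\rho$ in scope of $\Xi$, $t$ in scope of $\Xi,z$, and exactly one case $a$ for each constructor $\mathrm C\,\Xi':\mathcal T\rho'$ of $\mathcal T$, either $\mathrm C\,\Xi'\mapsto e$ ($e$ in scope of $\Xi;\Xi'$) or $\mathrm C\,\Xi'\ \mathbf{absurd}$; - codata type: $\mathbf{codata}\ \mathcal T\Psi\{\overline{(z:\mathcal T\rho).\mathrm d\,\Xi:t}\}$, introducing $\mathcal T$ and destructors $\mathrm d$ (scoping as for definitions); - codefinition: $\mathbf{codef}\ \mathrm C\,\Xi:\mathcal T\rho\{\overline o\}$, with $\mathcal T$ a codata type and exactly one cocase $o$ for each destructor $(z:\mathcal T\rho').\mathrm d\,\Xi':t$ of $\mathcal T$, either $\mathrm d\,\Xi'\mapsto e$ ($e$ in scope of $\Xi;\Xi'$) or $\mathrm d\,\Xi'\ \mathbf{absurd}$. Each name is declared at most once in $\Theta$. **Judgments** (simultaneously inductively defined, relative to $\Theta$). Contexts: $\vdash_\Theta\emptyset\ \mathrm{ctx}$; $\vdash_\Theta\Gamma,x:t\ \mathrm{ctx}$ if $\vdash_\Theta\Gamma\ \mathrm{ctx}$ and $\Gamma\vdash_\Theta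 t:\mathrm{Type}$. Telescopes: $\Gamma\vdash_\Theta\emptyset\ \mathrm{tel}$ if $\vdash_\Theta\Gamma\ \mathrm{ctx}$; $\Gamma\vdash_\Theta (x:t,\Xi)\ \mathrm{tel}$ if $\Gamma\vdash_\Theta t:\mathrm{Type}$ and $\Gamma,x:t\vdash_\Theta\Xi\ \mathrm{tel}$. Substitutions: $\Gamma\vdash_\Theta():\emptyset$ if $\vdash_\Theta\Gamma\ \mathrm{ctx}$; $\Gamma\vdash_\Theta(e,\sigma):(x:t,\Xi)$ if $\Gamma\vdash_\Theta e:t$ and $\Gamma\vdash_\Theta\sigma:\Xi[e/x]$. Equality of substitutions: $\Gamma\vdash_\Theta()\equiv():\emptyset$ if $\vdash_\Theta\Gamma\ \mathrm{ctx}$; $\Gamma\vdash_\Theta(e,\sigma)\equiv(e',\sigma'):(x:t,\Xi)$ if $\Gamma\vdash_\Theta e\equiv e':t$ and $\Gamma\vdash_\Theta\sigma\equiv\sigma':\Xi[e/x]$. Typing: if $\vdash_\Theta\Gamma\ \mathrm{ctx}$ then $\Gamma\vdash_\Theta x:t$ for $(x:t)\in\Gamma$, and $\Gamma\vdash_\Theta\mathrm{Type}:\mathrm{Type}$. Conversion: $\Gamma\vdash_\Theta e:t$ and $\Gamma\vdash_\Theta t\equiv t':\mathrm{Type}$ give $\Gamma\vdash_\Theta e:t'$. Formation: if $\mathcal T\Psi$ is declared as a data or codata type and $\Gamma\vdash_\Theta\rho:\Psi$, then $\Gamma\vdash_\Theta\mathcal T\rho:\mathrm{Type}$. Introduction: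 if $\mathrm C\,\Xi:\mathcal T\rho$ is a constructor of a data type or the signature of a codefinition in $\Theta$ and $\Gamma\vdash_\Theta\sigma:\Xi$, then $\Gamma\vdash_\Theta\mathrm C\sigma:\mathcal T\rho[\sigma/\Xi]$. Elimination: if $(z:\mathcal T\rho).\mathrm d\,\Xi:t$ is the signature of a definition or a destructor of a codata type in $\Theta$, $\Gamma\vdash_\Theta\sigma:\Xi$ and $\Gamma\vdash_\Theta e:\mathcal T\rho[\sigma/\Xi]$, then $\Gamma\vdash_\Theta e.\mathrm d\sigma:t[\sigma/\Xi][e/z]$. Judgmental equality $\Gamma\vdash_\Theta e\equiv e':t$: the least relation closed under reflexivity (on typed expressions), symmetry, transitivity, conversion of $t$, the congruence rules for $\mathcal T\rho$, $\mathrm C\sigma$ and $e.\mathrm d\sigma$ (obtained from the typing rules by replacing the typing premises by equalities, the type being that of the left-hand side), and the computation rules: suppose $\Gamma\vdash_\Theta\sigma_1:\Xi_1$, $\Gamma\vdash_\Theta\sigma_2:\Xi_2$, $\Gamma\vdash_\Theta\rho_1[\sigma_1/\Xi_1]\equiv\rho_2[\sigma_2/\Xi_2]:\Psi$, and either (data) $\mathcal T\Psi$ is a data type in $\Theta$ with constructor $\mathrm C\,\Xi_1:\mathcal T\rho_1$ and $\mathbf{def}\ (z:\mathcal T\rho_2).\mathrm d\,\Xi_2:t\{\mathrm C\,\Xi_1\mapsto e,\dots\}\in\Theta$, or (codata) $\mathcal T\Psi$ is a codata type in $\Theta$ with destructor $(z:\mathcal T\rho_2).\mathrm d\,\Xi_2:t$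 and $\mathbf{codef}\ \mathrm C\,\Xi_1:\mathcal T\rho_1\{\mathrm d\,\Xi_2\mapsto e,\dots\}\in\Theta$; then $\Gamma\vdash_\Theta\mathrm C\sigma_1.\mathrm d\sigma_2\equiv e[\sigma_1/\Xi_1][\sigma_2/\Xi_2]:t[\sigma_2/\Xi_2][\mathrm C\sigma_1/z]$ (the two substitutions act on disjoint sets of variables and are understood simultaneously). **Unifiers.** For a context $\Delta$ and substitutions $\rho_1,\rho_2$ for $\Psi$ over $\Delta$, a unifier of $\rho_1\equiv\rho_2:\Psi$ is a context $\Gamma'$ with $\Gamma'\vdash_\Theta\theta:\Delta$ and $\Gamma'\vdash_\Theta\rho_1[\theta]\equiv\rho_2[\theta]:\Psi$; the context $\Gamma'$ is written $\Delta[\theta]$. It is a most general unifier (mgu) if for every unifier $(\Gamma'',\theta'')$ there is $\Gamma''\vdash_\Theta\theta':\Gamma'$ with $\Gamma''\vdash_\Theta\theta''\equiv\theta[\theta']:\Delta$. **Well-formed declarations.** $\vdash_\Theta\delta\ \mathrm{OK}$ holds in the following cases. - $\mathbf{data}\ \mathcal T\Psi\{\overline{\mathrm C\,\Xi:\mathcal T\rho}\}$: $\vdash_\Theta\Psi\ \mathrm{tel}$ and for each constructor $\vdash_\Theta\Xi\ \mathrm{tel}$, $\Xi\vdash_\Theta\rho:\Psi$. - $\mathbf{codata}\ \mathcal T\Psi\{\overline{(z:\mathcal T\rho).\mathrm d\,\Xi:t}\}$: $\vdash_\Theta\Psi\ \mathrm{tel}$ and for each destructor $\vdash_\Theta\Xi\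 \mathrm{tel}$, $\Xi\vdash_\Theta\rho:\Psi$, $\Xi;z:\mathcal T\rho\vdash_\Theta t:\mathrm{Type}$. - $\mathbf{def}\ (z:\mathcal T\rho_1).\mathrm d\,\Xi_1:t\{\overline a\}$: $\mathcal T\Psi$ is a data type of $\Theta$, $\Xi_1\vdash_\Theta\rho_1:\Psi$, $\Xi_1;z:\mathcal T\rho_1\vdash_\Theta t:\mathrm{Type}$, and for each constructor $\mathrm C\,\Xi_2:\mathcal T\rho_2$: a case $\mathrm C\,\Xi_2\mapsto e$ requires an mgu $\theta$ of $\rho_1\equiv\rho_2:\Psi$ over $\Xi_1;\Xi_2$ with $(\Xi_1;\Xi_2)[\theta]\vdash_\Theta e[\theta]:t[\mathrm C\,\mathrm{id}_{\Xi_2}/z][\theta]$; a case $\mathrm C\,\Xi_2\ \mathbf{absurd}$ requires that $\rho_1\equiv\rho_2:\Psi$ has no unifier over $\Xi_1;\Xi_2$. - $\mathbf{codef}\ \mathrm C\,\Xi_1:\mathcal T\rho_1\{\overline o\}$: $\mathcal T\Psi$ is a codata type of $\Theta$, $\Xi_1\vdash_\Theta\rho_1:\Psi$, and for each destructor $(z:\mathcal T\rho_2).\mathrm d\,\Xi_2:t$: a cocase $\mathrm d\,\Xi_2\mapsto e$ requires an mgu $\theta$ of $\rho_1\equiv\rho_2:\Psi$ over $\Xi_1;\Xi_2$ with $(\Xi_1;\Xi_2)[\theta]\vdash_\Theta e[\theta]:t[\mathrm C\,\mathrm{id}_{\Xi_1}/z][\theta]$; a cocase $\mathrm d\,\Xi_2\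 \mathbf{absurd}$ requires that $\rho_1\equiv\rho_2:\Psi$ has no unifier over $\Xi_1;\Xi_2$. **Transformations.** If $\mathcal T$ is a codata type in $\Theta$, the program $\mathcal D_{\mathcal T}(\Theta)$ is obtained from $\Theta$ by replacing the declaration $\mathbf{codata}\ \mathcal T\Psi\{\dots\}$ and all codefinitions of type $\mathcal T$ by: a data type $\mathbf{data}\ \mathcal T\Psi\{\dots\}$ having one constructor $\mathrm C\,\Xi_1:\mathcal T\rho_1$ for each codefinition $\mathbf{codef}\ \mathrm C\,\Xi_1:\mathcal T\rho_1\{\dots\}$ of $\Theta$; and, for each destructor $(z:\mathcal T\rho_2).\mathrm d\,\Xi_2:t$, a definition $\mathbf{def}\ (z:\mathcal T\rho_2).\mathrm d\,\Xi_2:t\{\dots\}$ whose case for $\mathrm C$ is $\mathrm C\,\Xi_1\mapsto e$ if the cocase for $\mathrm d$ in the codefinition $\mathrm C$ is $\mathrm d\,\Xi_2\mapsto e$, and $\mathrm C\,\Xi_1\ \mathbf{absurd}$ if that cocase is absurd. All other declarations are unchanged. If $\mathcal T$ is a data type in $\Theta$, $\mathcal R_{\mathcal T}(\Theta)$ is the inverse transformation: constructors become codefinitions, definitions on $\mathcal T$ become destructors of the codata type $\mathcal T$, and the cocase for $\mathrm d$ in the codefinition $\mathrm C$ is taken from the case for $\mathrm C$ in the definition $\mathrm d$. *)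

(* Defs.v *)
#[warnings="-notation-overridden"]
From mathcomp Require Import all_boot.
From Stdlib Require List.

Set Implicit Arguments.
Unset Strict Implicit.
Unset Printing Implicit Defensive.

Local Notation In := List.In.

(* Variables are de Bruijn indices: [Var 0] is the variable introduced last.
   A context or telescope x_1 : t_1, ..., x_n : t_n is the list
   [:: t_1; ...; t_n], each type being in scope of the entries to its left, so
   that a closed telescope literally is a context, Gamma, x : t is
   [rcons Gamma t], and Xi_1; Xi_2 (with Xi_2 closed) is [Xi_1 ++ Xi_2].
   Substitutions are listed in the order of their telescope.  As expressions
   bind no variables, closed telescopes and signatures need no weakening. *)

Section Language.

(* Names of types, producers (constructors and codefinitions) and consumers
   (destructors and definitions). *)
Context {TN CN DN : eqType}.

Inductive expr : Type :=
| Var of nat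
| Typ
| TyCon of TN & seq expr
| Pro of CN & seq expr
| Con of expr & DN & seq expr.

Fixpoint subst (f : nat -> expr) (e : expr) : expr :=
  match e with
  | Var i => f i
  | Typ => Typ
  | TyCon T rho => TyCon T (map (subst f) rho)
  | Pro C sigma => Pro C (map (subst f) sigma)
  | Con e d sigma => Con (subst f e) d (map (subst f) sigma)
  end.

Definition shift (k : nat) : expr -> expr := subst (fun i => Var (k + i)).

(* [inst sigma e] is e[sigma/Xi] for e in scope of (Gamma; Xi), with
   [size sigma = size Xi]; the entries of sigma and the result live in Gamma. *)
Definition inst (sigma : seq expr) : expr -> expr :=
  subst (fun i => nth (Var (i - size sigma)) (rev sigma) i).

Definition insts (sigma : seq expr) : seq expr -> seq expr :=
  map (inst sigma).

Definition up (f : nat -> expr) (i : nat) : expr :=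
  if i is i'.+1 then shift 1 (f i') else Var 0.

Fixpoint subst_tel (f : nat -> expr) (Xi : seq expr) : seq expr :=
  if Xi is t :: Xi' then subst f t :: subst_tel (up f) Xi' else [::].

(* Xi[e/x], for the tail Xi of a telescope x : t, Xi over the scope of e. *)
Definition inst_tel (e : expr) : seq expr -> seq expr :=
  subst_tel (fun i => if i is i'.+1 then Var i' else e).

(* The variables of a telescope of length n, seen from a scope in which k more
   variables have been introduced after it. *)
Definition ids (k n : nat) : seq expr := rev [seq Var i | i <- iota k n].

(* Renames from scope (Xi_1; Xi_2) to scope (Xi_2; Xi_1), where the two closed
   telescopes have lengths n1 and n2; with named variables this is the
   identity. *)
Definition swap (n1 n2 : nat) : expr -> expr :=
  subst (fun i => Var (if i < n2 then n1 + i else i - n2)).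

Fixpoint scoped (n : nat) (e : expr) : bool :=
  match e with
  | Var i => i < n
  | Typ => true
  | TyCon _ rho => all (scoped n) rho
  | Pro _ sigma => all (scoped n) sigma
  | Con e _ sigma => scoped n e && all (scoped n) sigma
  end.

Fixpoint tel_scoped (n : nat) (Xi : seq expr) : bool :=
  if Xi is t :: Xi' then scoped n t && tel_scoped n.+1 Xi' else true.

(* The signature C Xi : T rho (the type name T is kept separately). *)
Record psig := PSig {
  p_name : CN;
  p_tel : seq expr;
  p_ix : seq expr }.

(* The signature (z : T rho).d Xi : t, with rho in scope of Xi and t in scope
   of Xi, z. *)
Record csig := CSig {
  c_name : DN;
  c_ix : seq expr;
  c_tel : seq expr;
  c_type : expr }.

(* A case of a definition d Xi is (C, Some e) for C Xi' |-> e, with e in scope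
   of (Xi; Xi'), and (C, None) for C Xi' absurd; the telescope Xi' is the one
   in the declaration of C.  Likewise for the cocases of a codefinition C Xi,
   whose bodies are in scope of Xi followed by the destructor's telescope. *)
Inductive decl : Type :=
| Data of TN & seq expr & seq psig
| Def of TN & csig & seq (CN * option expr)
| Codata of TN & seq expr & seq csig
| Codef of TN & psig & seq (DN * option expr).

Definition type_names (Theta : seq decl) : seq TN :=
  flatten [seq match delta with
               | Data T _ _ | Codata T _ _ => [:: T]
               | _ => [::]
               end | delta <- Theta].

Definition producer_names (Theta : seq decl) : seq CN :=
  flatten [seq match delta with
               | Data _ _ cs => map p_name cs
               | Codef _ s _ => [:: p_name s]
               | _ => [::]
               end | delta <- Theta].

Definition consumer_names (Theta : seq decl) : seq DN :=
  flatten [seq match delta with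
               | Codata _ _ ds => map c_name ds
               | Def _ s _ => [:: c_name s]
               | _ => [::]
               end | delta <- Theta].

Definition psig_scoped (s : psig) : bool :=
  tel_scoped 0 (p_tel s) && all (scoped (size (p_tel s))) (p_ix s).

Definition csig_scoped (s : csig) : bool :=
  [&& tel_scoped 0 (c_tel s), all (scoped (size (c_tel s))) (c_ix s)
    & scoped (size (c_tel s)).+1 (c_type s)].

Definition decl_valid (Theta : seq decl) (delta : decl) : Prop :=
  match delta with
  | Data _ Psi cs => tel_scoped 0 Psi && all psig_scoped cs
  | Codata _ Psi ds => tel_scoped 0 Psi && all csig_scoped ds
  | Def T s cases =>
      csig_scoped s /\
      exists Psi cs,
        [/\ In (Data T Psi cs) Theta,
            perm_eq (map fst cases) (map p_name cs)
          & forall c e, In c cs -> In (p_name c, Some e) cases ->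
              scoped (size (c_tel s) + size (p_tel c)) e]
  | Codef T s cocases =>
      psig_scoped s /\
      exists Psi ds,
        [/\ In (Codata T Psi ds) Theta,
            perm_eq (map fst cocases) (map c_name ds)
          & forall d e, In d ds -> In (c_name d, Some e) cocases ->
              scoped (size (p_tel s) + size (c_tel d)) e]
  end.

Definition valid (Theta : seq decl) : Prop :=
  [/\ uniq (type_names Theta), uniq (producer_names Theta),
      uniq (consumer_names Theta)
    & forall delta, In delta Theta -> decl_valid Theta delta].

Section Judgments.

Variable Theta : seq decl.

Definition is_type (T : TN) (Psi : seq expr) : Prop :=
  (exists cs, In (Data T Psi cs) Theta) \/
  (exists ds, In (Codata T Psi ds) Theta).

Definition is_producer (T : TN) (s : psig) : Prop :=
  (exists Psi cs, In (Data T Psi cs) Theta /\ In s cs) \/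
  (exists cocases, In (Codef T s cocases) Theta).

Definition is_consumer (T : TN) (s : csig) : Prop :=
  (exists cases, In (Def T s cases) Theta) \/
  (exists Psi ds, In (Codata T Psi ds) Theta /\ In s ds).

Inductive ctx_ok : seq expr -> Prop :=
| ctx_nil : ctx_ok [::]
| ctx_rcons Gamma t :
    ctx_ok Gamma -> has_type Gamma t Typ -> ctx_ok (rcons Gamma t)

with tel_ok : seq expr -> seq expr -> Prop :=
| tel_nil Gamma : ctx_ok Gamma -> tel_ok Gamma [::]
| tel_cons Gamma t Xi :
    has_type Gamma t Typ -> tel_ok (rcons Gamma t) Xi ->
    tel_ok Gamma (t :: Xi)

with has_types : seq expr -> seq expr -> seq expr -> Prop :=
| types_nil Gamma : ctx_ok Gamma -> has_types Gamma [::] [::]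
| types_cons Gamma e sigma t Xi :
    has_type Gamma e t -> has_types Gamma sigma (inst_tel e Xi) ->
    has_types Gamma (e :: sigma) (t :: Xi)

with eq_exprs : seq expr -> seq expr -> seq expr -> seq expr -> Prop :=
| eqs_nil Gamma : ctx_ok Gamma -> eq_exprs Gamma [::] [::] [::]
| eqs_cons Gamma e e' sigma sigma' t Xi :
    eq_expr Gamma e e' t -> eq_exprs Gamma sigma sigma' (inst_tel e Xi) ->
    eq_exprs Gamma (e :: sigma) (e' :: sigma') (t :: Xi)

with has_type : seq expr -> expr -> expr -> Prop :=
| type_var Gamma i :
    ctx_ok Gamma -> i < size Gamma ->
    has_type Gamma (Var i) (shift i.+1 (nth Typ (rev Gamma) i))
| type_typ Gamma : ctx_ok Gamma -> has_type Gamma Typ Typ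
| type_conv Gamma e t t' :
    has_type Gamma e t -> eq_expr Gamma t t' Typ -> has_type Gamma e t'
| type_tycon Gamma T Psi rho :
    is_type T Psi -> has_types Gamma rho Psi ->
    has_type Gamma (TyCon T rho) Typ
| type_pro Gamma T s sigma :
    is_producer T s -> has_types Gamma sigma (p_tel s) ->
    has_type Gamma (Pro (p_name s) sigma) (TyCon T (insts sigma (p_ix s)))
| type_con Gamma T s e sigma :
    is_consumer T s -> has_types Gamma sigma (c_tel s) ->
    has_type Gamma e (TyCon T (insts sigma (c_ix s))) ->
    has_type Gamma (Con e (c_name s) sigma) (inst (rcons sigma e) (c_type s))

with eq_expr : seq expr -> expr -> expr -> expr -> Prop :=
| eqe_refl Gamma e t : has_type Gamma e t -> eq_expr Gamma e e t
| eqe_sym Gamma e e' t : eq_expr Gamma e e' t -> eq_expr Gamma e' e t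
| eqe_trans Gamma e e' e'' t :
    eq_expr Gamma e e' t -> eq_expr Gamma e' e'' t -> eq_expr Gamma e e'' t
| eqe_conv Gamma e e' t t' :
    eq_expr Gamma e e' t -> eq_expr Gamma t t' Typ -> eq_expr Gamma e e' t'
| eqe_tycon Gamma T Psi rho rho' :
    is_type T Psi -> eq_exprs Gamma rho rho' Psi ->
    eq_expr Gamma (TyCon T rho) (TyCon T rho') Typ
| eqe_pro Gamma T s sigma sigma' :
    is_producer T s -> eq_exprs Gamma sigma sigma' (p_tel s) ->
    eq_expr Gamma (Pro (p_name s) sigma) (Pro (p_name s) sigma')
      (TyCon T (insts sigma (p_ix s)))
| eqe_con Gamma T s e e' sigma sigma' :
    is_consumer T s -> eq_exprs Gamma sigma sigma' (c_tel s) ->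
    eq_expr Gamma e e' (TyCon T (insts sigma (c_ix s))) ->
    eq_expr Gamma (Con e (c_name s) sigma) (Con e' (c_name s) sigma')
      (inst (rcons sigma e) (c_type s))
| eqe_data Gamma T Psi cs c d cases e sigma1 sigma2 :
    In (Data T Psi cs) Theta -> In c cs ->
    In (Def T d cases) Theta -> In (p_name c, Some e) cases ->
    has_types Gamma sigma1 (p_tel c) -> has_types Gamma sigma2 (c_tel d) ->
    eq_exprs Gamma (insts sigma1 (p_ix c)) (insts sigma2 (c_ix d)) Psi ->
    eq_expr Gamma (Con (Pro (p_name c) sigma1) (c_name d) sigma2)
      (inst (sigma2 ++ sigma1) e)
      (inst (rcons sigma2 (Pro (p_name c) sigma1)) (c_type d))
| eqe_codata Gamma T Psi ds c d cocases e sigma1 sigma2 :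
    In (Codata T Psi ds) Theta -> In d ds ->
    In (Codef T c cocases) Theta -> In (c_name d, Some e) cocases ->
    has_types Gamma sigma1 (p_tel c) -> has_types Gamma sigma2 (c_tel d) ->
    eq_exprs Gamma (insts sigma1 (p_ix c)) (insts sigma2 (c_ix d)) Psi ->
    eq_expr Gamma (Con (Pro (p_name c) sigma1) (c_name d) sigma2)
      (inst (sigma1 ++ sigma2) e)
      (inst (rcons sigma2 (Pro (p_name c) sigma1)) (c_type d)).

Definition unifier (Delta rho1 rho2 Psi Gamma theta : seq expr) : Prop :=
  has_types Gamma theta Delta /\
  eq_exprs Gamma (insts theta rho1) (insts theta rho2) Psi.

Definition mgu (Delta rho1 rho2 Psi Gamma theta : seq expr) : Prop :=
  unifier Delta rho1 rho2 Psi Gamma theta /\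
  forall Gamma' theta', unifier Delta rho1 rho2 Psi Gamma' theta' ->
    exists tau, has_types Gamma' tau Gamma /\
                eq_exprs Gamma' theta' (insts tau theta) Delta.

(* A clause over Delta = Xi_1; Xi_2 whose body, if any, must have type t. *)
Definition clause_ok (Delta rho1 rho2 Psi : seq expr) (t : expr)
    (body : option expr) : Prop :=
  match body with
  | Some e => exists Gamma theta,
      mgu Delta rho1 rho2 Psi Gamma theta /\
      has_type Gamma (inst theta e) (inst theta t)
  | None => ~ exists Gamma theta, unifier Delta rho1 rho2 Psi Gamma theta
  end.

(* For definitions and codefinitions, n1 and n2 are the lengths of Xi_1 and
   Xi_2; [ids n2 n1] and [ids 0 n2] are id_{Xi_1} and id_{Xi_2} in scope
   (Xi_1; Xi_2), and [shift n2] moves rho_1 from scope Xi_1 to that scope. *)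
Definition decl_ok (delta : decl) : Prop :=
  match delta with
  | Data T Psi cs =>
      tel_ok [::] Psi /\
      forall c, In c cs ->
        tel_ok [::] (p_tel c) /\ has_types (p_tel c) (p_ix c) Psi
  | Codata T Psi ds =>
      tel_ok [::] Psi /\
      forall d, In d ds ->
        [/\ tel_ok [::] (c_tel d), has_types (c_tel d) (c_ix d) Psi
          & has_type (rcons (c_tel d) (TyCon T (c_ix d))) (c_type d) Typ]
  | Def T d cases =>
      exists Psi cs,
        [/\ In (Data T Psi cs) Theta,
            has_types (c_tel d) (c_ix d) Psi,
            has_type (rcons (c_tel d) (TyCon T (c_ix d))) (c_type d) Typ
          & forall c body, In c cs -> In (p_name c, body) cases ->
              let n1 := size (c_tel d) in
              let n2 := size (p_tel c) in
              clause_ok (c_tel d ++ p_tel c)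
                (map (shift n2) (c_ix d)) (p_ix c) Psi
                (inst (rcons (ids n2 n1) (Pro (p_name c) (ids 0 n2)))
                   (c_type d))
                body]
  | Codef T c cocases =>
      exists Psi ds,
        [/\ In (Codata T Psi ds) Theta,
            has_types (p_tel c) (p_ix c) Psi
          & forall d body, In d ds -> In (c_name d, body) cocases ->
              let n1 := size (p_tel c) in
              let n2 := size (c_tel d) in
              clause_ok (p_tel c ++ c_tel d)
                (map (shift n2) (p_ix c)) (c_ix d) Psi
                (inst (rcons (ids 0 n2) (Pro (p_name c) (ids n2 n1)))
                   (c_type d))
                body]
  end.

Definition well_formed : Prop :=
  forall delta, In delta Theta -> decl_ok delta.

End Judgments.

Definition is_codata (T : TN) (delta : decl) : bool :=
  if delta is Codata T' _ _ then T' == T else false.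

Definition is_data (T : TN) (delta : decl) : bool :=
  if delta is Data T' _ _ then T' == T else false.

Definition codefs_of (T : TN) (Theta : seq decl) :=
  pmap (fun delta => if delta is Codef T' c cocases then
                       if T' == T then Some (c, cocases) else None
                     else None) Theta.

Definition defs_of (T : TN) (Theta : seq decl) :=
  pmap (fun delta => if delta is Def T' d cases then
                       if T' == T then Some (d, cases) else None
                     else None) Theta.

(* In a program every inner sequence below has exactly one element. *)
Definition cases_from (d : csig)
    (codefs : seq (psig * seq (DN * option expr))) : seq (CN * option expr) :=
  [seq (p_name k.1,
        omap (swap (size (p_tel k.1)) (size (c_tel d))) a.2)
  | k <- codefs, a <- [seq a <- k.2 | a.1 == c_name d]].

Definition cocases_from (c : psig)
    (defs : seq (csig * seq (CN * option expr))) : seq (DN * option expr) :=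
  [seq (c_name k.1,
        omap (swap (size (c_tel k.1)) (size (p_tel c))) a.2)
  | k <- defs, a <- [seq a <- k.2 | a.1 == p_name c]].

Definition defunc_decl (T : TN) codefs (delta : decl) : seq decl :=
  match delta with
  | Codata T' Psi ds =>
      if T' == T then
        Data T Psi (map fst codefs) ::
        [seq Def T d (cases_from d codefs) | d <- ds]
      else [:: delta]
  | Codef T' _ _ => if T' == T then [::] else [:: delta]
  | _ => [:: delta]
  end.

Definition defunc_decls (T : TN) (Theta : seq decl) : seq decl :=
  flatten [seq defunc_decl T (codefs_of T Theta) delta | delta <- Theta].

Definition refunc_decl (T : TN) defs (delta : decl) : seq decl :=
  match delta with
  | Data T' Psi cs =>
      if T' == T then
        Codata T Psi (map fst defs) ::
        [seq Codef T c (cocases_from c defs) | c <- cs]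
      else [:: delta]
  | Def T' _ _ => if T' == T then [::] else [:: delta]
  | _ => [:: delta]
  end.

Definition refunc_decls (T : TN) (Theta : seq decl) : seq decl :=
  flatten [seq refunc_decl T (defs_of T Theta) delta | delta <- Theta].

Lemma In_cat T (x : T) (s1 s2 : seq T) :
  In x (s1 ++ s2) <-> In x s1 \/ In x s2.
Proof. exact: List.in_app_iff. Qed.

Lemma In_map S T (f : S -> T) y (s : seq S) :
  In y (map f s) <-> exists x, f x = y /\ In x s.
Proof. exact: List.in_map_iff. Qed.

Lemma In_flatten S T (f : S -> seq T) y (s : seq S) :
  In y (flatten (map f s)) <-> exists x, In x s /\ In y (f x).
Proof.
elim: s => [|x s IHs] /=; first by split=> [|[x []]].
rewrite In_cat IHs; split=> [[xy|[z [zs zy]]]|[z [[<-|zs] zy]]].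
- by exists x; split; [left|].
- by exists z; split; [right|].
- by left.
- by right; exists z.
Qed.

Lemma In_mem (T : eqType) (x : T) (s : seq T) : In x s <-> x \in s.
Proof.
elim: s => //= y s ->; rewrite inE eq_sym.
by split=> [[/eqP->|->]|/orP[/eqP|]]; rewrite ?orbT //; [left|right].
Qed.

Lemma allIn (T : Type) (p : pred T) (s : seq T) :
  all p s <-> forall x, In x s -> p x.
Proof.
elim: s => //= y s [IH1 IH2]; split=> [/andP[py ps] x [<-|]|H] //.
  exact: IH1.
by apply/andP; split; [apply: H; left|apply: IH2 => x xs; apply: H; right].
Qed.

Lemma uniq_mapIn T (U : eqType) (f : T -> U) (s : seq T) x y :
  uniq (map f s) -> In x s -> In y s -> f x = f y -> x = y.
Proof.
elim: s => //= z s IHs /andP[zs us] [<-|xs] [<-|ys] // fxy.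
- by case/negP: zs; rewrite fxy; apply/In_mem/In_map; exists y.
- by case/negP: zs; rewrite -fxy; apply/In_mem/In_map; exists x.
- exact: IHs.
Qed.

Lemma uniq_flattenIn S (U : eqType) (f : S -> seq U) (s : seq S) x :
  uniq (flatten (map f s)) -> In x s -> uniq (f x).
Proof.
elim: s => //= z s IHs; rewrite cat_uniq => /and3P[uz _ us] [<-|] //.
exact: IHs.
Qed.

Lemma expr_nested_ind (P : expr -> Prop) :
  (forall i, P (Var i)) -> P Typ ->
  (forall T rho, (forall e, In e rho -> P e) -> P (TyCon T rho)) ->
  (forall C sigma, (forall e, In e sigma -> P e) -> P (Pro C sigma)) ->
  (forall e d sigma, P e -> (forall e', In e' sigma -> P e') ->
    P (Con e d sigma)) ->
  forall e, P e.
Proof.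
move=> pvar ptyp ptycon ppro pcon.
pose all_P IH := fix go (s : seq expr) : forall e, In e s -> P e :=
  match s return forall e, In e s -> P e with
  | [::] => fun e ex => match ex with end
  | x :: s' => fun e ex =>
      match ex with
      | or_introl xe => eq_ind x P (IH x) e xe
      | or_intror es => go s' e es
      end
  end.
exact: (fix IH e : P e :=
  match e with
  | Var i => pvar i
  | Typ => ptyp
  | TyCon T rho => ptycon T rho (all_P IH rho)
  | Pro C sigma => ppro C sigma (all_P IH sigma)
  | Con e d sigma => pcon e d sigma (IH e) (all_P IH sigma)
  end).
Qed.

Lemma scoped_swap n1 n2 e :
  scoped (n1 + n2) e -> scoped (n2 + n1) (swap n1 n2 e).
Proof.
have alls s : (forall e, In e s -> scoped (n1 + n2) e ->
    scoped (n2 + n1) (swap n1 n2 e)) -> all (scoped (n1 + n2)) s ->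
    all (scoped (n2 + n1)) (map (swap n1 n2) s).
  move=> H /allIn sc; apply/allIn => x /In_map[y [<- ys]].
  exact: H ys (sc y ys).
elim/expr_nested_ind: e => //=.
- move=> i lt_i; case: (ltnP i n2) => hi; first by rewrite (addnC n2) ltn_add2l.
  by rewrite ltn_subLR // (leq_trans lt_i) // addnC leq_add2l leq_addl.
- by move=> e d sigma IHe IHs /andP[/IHe he hs]; apply/andP; split;
    [|exact: (alls sigma IHs hs)].
Qed.

Lemma In_codefs T Theta k :
  In k (codefs_of T Theta) <-> In (Codef T k.1 k.2) Theta.
Proof.
case: k => c os /=; elim: Theta => //= delta Theta IH.
case: delta => [T' Psi cs|T' d ms|T' Psi ds|T' c' os'] /=;
  try by rewrite IH; split=> [|[]]; [right| |].
case: eqP => [->|ne] /=; rewrite IH; split.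
- by case=> [[-> ->]|]; [left|right].
- by case=> [[-> ->]|]; [left|right].
- by right.
- by case=> // -[].
Qed.

Lemma In_defs T Theta k :
  In k (defs_of T Theta) <-> In (Def T k.1 k.2) Theta.
Proof.
case: k => c os /=; elim: Theta => //= delta Theta IH.
case: delta => [T' Psi cs|T' d ms|T' Psi ds|T' c' os'] /=;
  try by rewrite IH; split=> [|[]]; [right| |].
case: eqP => [->|ne] /=; rewrite IH; split.
- by case=> [[-> ->]|]; [left|right].
- by case=> [[-> ->]|]; [left|right].
- by right.
- by case=> // -[].
Qed.

Lemma In_defunc T Theta delta :
  In delta (defunc_decls T Theta) <->
  [\/ exists Psi ds, In (Codata T Psi ds) Theta /\
        delta = Data T Psi (map fst (codefs_of T Theta)),
      exists Psi ds d, [/\ In (Codata T Psi ds) Theta, In d ds &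
        delta = Def T d (cases_from d (codefs_of T Theta))]
    | [/\ In delta Theta, forall Psi ds, delta <> Codata T Psi ds
        & forall c os, delta <> Codef T c os]].
Proof.
rewrite /defunc_decls; split=> [/In_flatten[x [xT]]|].
  case: x xT => [T' Psi cs|T' d ms|T' Psi ds|T' c' os'] /= xT.
  - by case=> // <-; constructor 3.
  - by case=> // <-; constructor 3.
  - case: eqP xT => [-> xT|ne xT [<-|//]].
      case=> [<-|]; first by constructor 1; exists Psi, ds.
      by case/In_map => d [<- dd]; constructor 2; exists Psi, ds, d.
    by constructor 3; split=> // ? ? [].
  - case: eqP xT => // ne xT [<-|//].
    by constructor 3; split=> // ? ? [].
case=> [[Psi [ds [xT ->]]]|[Psi [ds [d [xT dd ->]]]]|[xT n1 n2]];
  apply/In_flatten.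
- by exists (Codata T Psi ds); rewrite /= eqxx; split=> //; left.
- exists (Codata T Psi ds); rewrite /= eqxx; split=> //; right.
  by apply/In_map; exists d.
- exists delta; split=> //.
  case: delta xT n1 n2 => [T' Psi cs|T' d ms|T' Psi ds|T' c os] xT n1 n2 /=;
    [by left|by left| |].
  + by case: eqP n1 => [->|_ _]; [move/(_ Psi ds)|left].
  + by case: eqP n2 => [->|_ _]; [move/(_ c os)|left].
Qed.

Lemma In_refunc T Theta delta :
  In delta (refunc_decls T Theta) <->
  [\/ exists Psi cs, In (Data T Psi cs) Theta /\
        delta = Codata T Psi (map fst (defs_of T Theta)),
      exists Psi cs c, [/\ In (Data T Psi cs) Theta, In c cs &
        delta = Codef T c (cocases_from c (defs_of T Theta))]
    | [/\ In delta Theta, forall Psi cs, delta <> Data T Psi cs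
        & forall d ms, delta <> Def T d ms]].
Proof.
rewrite /refunc_decls; split=> [/In_flatten[x [xT]]|].
  case: x xT => [T' Psi cs|T' d ms|T' Psi ds|T' c' os'] /= xT.
  - case: eqP xT => [-> xT|ne xT [<-|//]].
      case=> [<-|]; first by constructor 1; exists Psi, cs.
      by case/In_map => c [<- cc]; constructor 2; exists Psi, cs, c.
    by constructor 3; split=> // ? ? [].
  - case: eqP xT => // ne xT [<-|//].
    by constructor 3; split=> // ? ? [].
  - by case=> // <-; constructor 3.
  - by case=> // <-; constructor 3.
case=> [[Psi [cs [xT ->]]]|[Psi [cs [c [xT cc ->]]]]|[xT n1 n2]];
  apply/In_flatten.
- by exists (Data T Psi cs); rewrite /= eqxx; split=> //; left.
- exists (Data T Psi cs); rewrite /= eqxx; split=> //; right.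
  by apply/In_map; exists c.
- exists delta; split=> //.
  case: delta xT n1 n2 => [T' Psi cs|T' d ms|T' Psi ds|T' c os] xT n1 n2 /=;
    [| |by left|by left].
  + by case: eqP n1 => [->|_ _]; [move/(_ Psi cs)|left].
  + by case: eqP n2 => [->|_ _]; [move/(_ d ms)|left].
Qed.

Lemma type_names_inj Theta T delta delta' :
  uniq (type_names Theta) -> In delta Theta -> In delta' Theta ->
  is_data T delta || is_codata T delta ->
  is_data T delta' || is_codata T delta' -> delta = delta'.
Proof.
have nm x : In x Theta -> is_data T x || is_codata T x ->
    T \in type_names Theta.
  move=> xT hx; apply/In_mem/In_flatten; exists x; split=> //.
  by case: x hx {xT} => [T' ? ?| |T' ? ?|] //=; rewrite ?orbF;
    move/eqP ->; left.
elim: Theta nm => //= x Theta IH nm.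
rewrite /type_names /= cat_uniq -/(type_names Theta) => /and3P[_ /hasPn dis us].
have nm' y : In y Theta -> is_data T y || is_codata T y ->
    T \in type_names Theta.
  move=> yT hy; apply/In_mem/In_flatten; exists y; split=> //.
  by case: y hy {yT} => [T' ? ?| |T' ? ?|] //=; rewrite ?orbF;
    move/eqP ->; left.
have excl y : In y Theta -> is_data T y || is_codata T y ->
    is_data T x || is_codata T x -> False.
  move=> yT hy hx; have /negP := dis T (nm' y yT hy); apply.
  by case: x hx {dis nm IH} => [T' ? ?| |T' ? ?|] //=; rewrite ?orbF;
    move/eqP ->; rewrite inE.
move=> [<-|yT] [<-|zT] // hy hz.
- by case: (excl delta').
- by case: (excl delta).
- exact: IH.
Qed.

Lemma type_names_cons delta Theta :
  type_names (delta :: Theta) = type_names [:: delta] ++ type_names Theta.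
Proof. by rewrite /type_names /= cats0. Qed.

Lemma type_names_cat Theta1 Theta2 :
  type_names (Theta1 ++ Theta2) = type_names Theta1 ++ type_names Theta2.
Proof. by rewrite /type_names map_cat flatten_cat. Qed.

Lemma producer_names_cons delta Theta :
  producer_names (delta :: Theta) =
  producer_names [:: delta] ++ producer_names Theta.
Proof. by rewrite /producer_names /= cats0. Qed.

Lemma producer_names_cat Theta1 Theta2 :
  producer_names (Theta1 ++ Theta2) =
  producer_names Theta1 ++ producer_names Theta2.
Proof. by rewrite /producer_names map_cat flatten_cat. Qed.

Lemma consumer_names_cons delta Theta :
  consumer_names (delta :: Theta) =
  consumer_names [:: delta] ++ consumer_names Theta.
Proof. by rewrite /consumer_names /= cats0. Qed.

Lemma consumer_names_cat Theta1 Theta2 :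
  consumer_names (Theta1 ++ Theta2) =
  consumer_names Theta1 ++ consumer_names Theta2.
Proof. by rewrite /consumer_names map_cat flatten_cat. Qed.

Lemma names_Defs T (f : csig -> seq (CN * option expr)) ds :
  [/\ type_names [seq Def T d (f d) | d <- ds] = [::],
      producer_names [seq Def T d (f d) | d <- ds] = [::]
    & consumer_names [seq Def T d (f d) | d <- ds] = map c_name ds].
Proof.
elim: ds => //= d ds [IHt IHp IHc]; split.
- by rewrite type_names_cons IHt.
- by rewrite producer_names_cons IHp.
- by rewrite consumer_names_cons IHc.
Qed.

Lemma names_Codefs T (f : psig -> seq (DN * option expr)) cs :
  [/\ type_names [seq Codef T c (f c) | c <- cs] = [::],
      consumer_names [seq Codef T c (f c) | c <- cs] = [::]
    & producer_names [seq Codef T c (f c) | c <- cs] = map p_name cs].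
Proof.
elim: cs => //= d ds [IHt IHp IHc]; split.
- by rewrite type_names_cons IHt.
- by rewrite consumer_names_cons IHp.
- by rewrite producer_names_cons IHc.
Qed.

Lemma count_types T Theta :
  uniq (type_names Theta) ->
  count (is_data T) Theta + count (is_codata T) Theta <= 1.
Proof.
move=> ut; suff -> : count (is_data T) Theta + count (is_codata T) Theta =
    count_mem T (type_names Theta).
  by rewrite count_uniq_mem // leq_b1.
elim: Theta {ut} => //= delta Theta IH.
rewrite type_names_cons count_cat -IH addnACA; congr (_ + _).
by case: delta => [T' ? ?|? ? ?|T' ? ?|? ? ?] //=; rewrite ?addn0.
Qed.

Lemma names_defunc T (Theta : seq decl) :
  valid Theta ->
  [/\ type_names (defunc_decls T Theta) = type_names Theta,
      consumer_names (defunc_decls T Theta) = consumer_names Theta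
    & perm_eq (producer_names (defunc_decls T Theta))
              (producer_names Theta)].
Proof.
case=> ut up_ uc vT; rewrite /defunc_decls; set K := codefs_of T Theta.
split.
- move: K => K; elim: Theta {ut up_ uc vT} => //= x Theta IH.
  rewrite type_names_cat IH [RHS]type_names_cons; congr (_ ++ _).
  case: x => [? ? ?|? ? ?|T' Psi ds|T' ? ?] //=; case: eqP => // e.
  rewrite type_names_cons e.
  by have [-> _ _] := names_Defs T (cases_from^~ K) ds.
- move: K => K; elim: Theta {ut up_ uc vT} => //= x Theta IH.
  rewrite consumer_names_cat IH [RHS]consumer_names_cons; congr (_ ++ _).
  case: x => [? ? ?|? ? ?|T' Psi ds|T' ? ?] //=; case: eqP => // e.
  rewrite consumer_names_cons.
  have [_ _ ->] := names_Defs T (cases_from^~ K) ds.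
  by rewrite /consumer_names /= cats0.
apply/permP => p.
have main Th : count p (producer_names
      (flatten [seq defunc_decl T K delta | delta <- Th])) +
    count p [seq p_name k.1 | k <- codefs_of T Th] =
    count p (producer_names Th) +
    count (is_codata T) Th * count p [seq p_name k.1 | k <- K].
  elim: Th => //= x Th IH.
  rewrite producer_names_cat count_cat [producer_names (x :: _)]producer_names_cons
    count_cat mulnDl -[RHS]addnACA -IH.
  rewrite [X in _ + X](_ : _ = count p [seq p_name k.1 |
    k <- codefs_of T [:: x]] + count p [seq p_name k.1 | k <- codefs_of T Th]);
    last first.
    rewrite -count_cat -map_cat; congr (count _ (map _ _)).
    by case: x => //= T' c os; case: ifP.
  rewrite addnACA; congr (_ + _).
  case: x => [? ? ?|? ? ?|T' Psi ds|T' c os] //=.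
    case: (T' =P T) => // e.
    rewrite producer_names_cons.
    have [_ -> _] := names_Defs T (cases_from^~ K) ds.
    by rewrite /producer_names /= !cats0 -map_comp mul1n addn0.
  by case: (T' =P T) => // e; rewrite /= !addn0.
have := main Theta; rewrite -/K.
have := count_types T ut; case: (posnP (count (is_codata T) Theta)) => [c0 _|].
  rewrite c0 mul0n addn0.
  suff -> : K = [::] by rewrite /= addn0.
  case defK: K => [//|k K'].
  have /In_codefs/vT[_ [Psi [ds [dT _ _]]]] : In k K by rewrite defK; left.
  have : ~~ has (is_codata T) Theta by rewrite has_count c0.
  clear -dT; elim: Theta dT => //= x Th IH [->|/IH] /=.
    by rewrite eqxx.
  by move=> H /norP[_ /H].
case: (count (is_codata T) Theta) => [|[|n]] // _.
  by move=> _; rewrite mul1n => /addIn.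
by rewrite !addnS.
Qed.

Lemma valid_defunc T (Theta : seq decl) :
  valid Theta -> valid (defunc_decls T Theta).
Proof.
move=> vT; have [et ec ep] := names_defunc T vT.
case: vT => ut up_ uc vT.
split; rewrite ?et ?ec ?(perm_uniq ep) //.
have keep x : In x Theta -> (forall Psi ds, x <> Codata T Psi ds) ->
    (forall c os, x <> Codef T c os) -> In x (defunc_decls T Theta).
  by move=> xT n1 n2; apply/In_defunc; constructor 3.
have uK : uniq [seq p_name k.1 | k <- codefs_of T Theta].
  move: up_; clear; elim: Theta => //= x Theta IH.
  rewrite producer_names_cons cat_uniq => /and3P[_ /hasPn dis /IH {}IH].
  case: x dis => //= T' c os dis; case: ifP => // /eqP e /=.
  rewrite IH andbT; apply/negP => /In_mem/In_map[k [ek /In_codefs kT]].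
  have /dis : p_name c \in producer_names Theta.
    apply/In_mem/In_flatten; exists (Codef T k.1 k.2); split=> //=.
    by left.
  by rewrite inE eqxx.
move=> delta /In_defunc[[Psi [ds [dT ->]]]|[Psi [ds [d [dT dd ->]]]]|].
- have /= /andP[-> _] := vT _ dT; apply/allIn => c /In_map[k [<- /In_codefs kT]].
  by have [] := vT _ kT.
- have /= /andP[_ /allIn/(_ d dd) sd] := vT _ dT; split=> //.
  exists Psi, [seq k.1 | k <- codefs_of T Theta]; split.
  + by apply/In_defunc; constructor 1; exists Psi, ds.
  + have ud : uniq (map c_name ds).
      exact: (uniq_flattenIn uc dT).
    have one k : In k (codefs_of T Theta) ->
        size [seq a <- k.2 | a.1 == c_name d] = 1.
      move=> /In_codefs/vT[_ [Psi' [ds' [dT' pk _]]]].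
      have e : Codata T Psi' ds' = Codata T Psi ds.
        by apply: (@type_names_inj _ T _ _ ut dT' dT); rewrite /= eqxx.
      case: e pk => _ -> pk.
      rewrite size_filter -(count_map fst (pred1 (c_name d))).
      rewrite (permP pk) count_uniq_mem //.
      by have /In_mem -> : In (c_name d) (map c_name ds)
        by apply/In_map; exists d.
    rewrite (_ : map fst _ = map p_name [seq k.1 | k <- codefs_of T Theta]) //.
    rewrite /cases_from; elim: (codefs_of T Theta) one => //= k K IH one.
    rewrite map_cat IH; last by move=> k' k'K; apply: one; right.
    rewrite -map_comp; have := one k (or_introl erefl).
    by case: [seq _ <- _ | _] => [|x [|]].
  + move=> c e /In_map[k [<- kK]] /In_flatten[k' [k'K]].
    case/In_map=> -[d' [b|]] [//= [ek <-]] /List.filter_In[aK /eqP /= ed].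
    have ekk : k' = k.
      exact: (uniq_mapIn uK k'K kK ek).
    move: aK; rewrite {}ekk {}ed => aK.
    apply: scoped_swap.
    have /In_codefs/vT[_ [Psi' [ds' [dT' _ sc]]]] := kK.
    have e' : Codata T Psi' ds' = Codata T Psi ds.
      by apply: (@type_names_inj _ T _ _ ut dT' dT); rewrite /= eqxx.
    by case: e' sc => _ -> /(_ d b dd aK).
- case=> dT n1 n2; have := vT _ dT.
  case: delta dT n1 n2 => //= T' s cs dT n1 n2 [ss [Psi [xs [xT pm sc]]]];
    split=> //; exists Psi, xs; split=> //.
  + exact: keep.
  + apply: keep => // Psi' ds' [eT _ _]; case: (n2 s cs); by rewrite eT.
Qed.

Lemma names_refunc T (Theta : seq decl) :
  valid Theta ->
  [/\ type_names (refunc_decls T Theta) = type_names Theta,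
      producer_names (refunc_decls T Theta) = producer_names Theta
    & perm_eq (consumer_names (refunc_decls T Theta))
              (consumer_names Theta)].
Proof.
case=> ut up_ uc vT; rewrite /refunc_decls; set K := defs_of T Theta.
split.
- move: K => K; elim: Theta {ut uc up_ vT} => //= x Theta IH.
  rewrite type_names_cat IH [RHS]type_names_cons; congr (_ ++ _).
  case: x => [T' Psi cs|T' ? ?|? ? ?|? ? ?] //=; case: eqP => // e.
  rewrite type_names_cons e.
  by have [-> _ _] := names_Codefs T (cocases_from^~ K) cs.
- move: K => K; elim: Theta {ut uc up_ vT} => //= x Theta IH.
  rewrite producer_names_cat IH [RHS]producer_names_cons; congr (_ ++ _).
  case: x => [T' Psi cs|T' ? ?|? ? ?|? ? ?] //=; case: eqP => // e.
  rewrite producer_names_cons.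
  have [_ _ ->] := names_Codefs T (cocases_from^~ K) cs.
  by rewrite /producer_names /= cats0.
apply/permP => p.
have main Th : count p (consumer_names
      (flatten [seq refunc_decl T K delta | delta <- Th])) +
    count p [seq c_name k.1 | k <- defs_of T Th] =
    count p (consumer_names Th) +
    count (is_data T) Th * count p [seq c_name k.1 | k <- K].
  elim: Th => //= x Th IH.
  rewrite consumer_names_cat count_cat [consumer_names (x :: _)]consumer_names_cons
    count_cat mulnDl -[RHS]addnACA -IH.
  rewrite [X in _ + X](_ : _ = count p [seq c_name k.1 |
    k <- defs_of T [:: x]] + count p [seq c_name k.1 | k <- defs_of T Th]);
    last first.
    rewrite -count_cat -map_cat; congr (count _ (map _ _)).
    by case: x => //= T' d ms; case: ifP.
  rewrite addnACA; congr (_ + _).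
  case: x => [T' Psi cs|T' d ms|? ? ?|? ? ?] //=.
    case: (T' =P T) => // e.
    rewrite consumer_names_cons.
    have [_ -> _] := names_Codefs T (cocases_from^~ K) cs.
    by rewrite /consumer_names /= !cats0 -map_comp mul1n addn0.
  by case: (T' =P T) => // e; rewrite /= !addn0.
have := main Theta; rewrite -/K.
have := count_types T ut; case: (posnP (count (is_data T) Theta)) => [c0 _|].
  rewrite c0 mul0n addn0.
  suff -> : K = [::] by rewrite /= addn0.
  case defK: K => [//|k K'].
  have /In_defs/vT[_ [Psi [cs [dT _ _]]]] : In k K by rewrite defK; left.
  have : ~~ has (is_data T) Theta by rewrite has_count c0.
  clear -dT; elim: Theta dT => //= x Th IH [->|/IH] /=.
    by rewrite eqxx.
  by move=> H /norP[_ /H].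
case: (count (is_data T) Theta) => [|[|n]] // _.
  by move=> _; rewrite mul1n => /addIn.
Qed.

Lemma valid_refunc T (Theta : seq decl) :
  valid Theta -> valid (refunc_decls T Theta).
Proof.
move=> vT; have [et ec ep] := names_refunc T vT.
case: vT => ut up_ uc vT.
split; rewrite ?et ?ec ?(perm_uniq ep) //.
have keep x : In x Theta -> (forall Psi cs, x <> Data T Psi cs) ->
    (forall d ms, x <> Def T d ms) -> In x (refunc_decls T Theta).
  by move=> xT n1 n2; apply/In_refunc; constructor 3.
have uK : uniq [seq c_name k.1 | k <- defs_of T Theta].
  move: uc; clear; elim: Theta => //= x Theta IH.
  rewrite consumer_names_cons cat_uniq => /and3P[_ /hasPn dis /IH {}IH].
  case: x dis => //= T' d ms dis; case: ifP => // /eqP e /=.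
  rewrite IH andbT; apply/negP => /In_mem/In_map[k [ek /In_defs kT]].
  have /dis : c_name d \in consumer_names Theta.
    apply/In_mem/In_flatten; exists (Def T k.1 k.2); split=> //=.
    by left.
  by rewrite inE eqxx.
move=> delta /In_refunc[[Psi [cs [dT ->]]]|[Psi [cs [c [dT cc ->]]]]|].
- have /= /andP[-> _] := vT _ dT; apply/allIn => d /In_map[k [<- /In_defs kT]].
  by have [] := vT _ kT.
- have /= /andP[_ /allIn/(_ c cc) sc] := vT _ dT; split=> //.
  exists Psi, [seq k.1 | k <- defs_of T Theta]; split.
  + by apply/In_refunc; constructor 1; exists Psi, cs.
  + have ucs : uniq (map p_name cs).
      exact: (uniq_flattenIn up_ dT).
    have one k : In k (defs_of T Theta) ->
        size [seq a <- k.2 | a.1 == p_name c] = 1.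
      move=> /In_defs/vT[_ [Psi' [cs' [dT' pk _]]]].
      have e : Data T Psi' cs' = Data T Psi cs.
        by apply: (@type_names_inj _ T _ _ ut dT' dT); rewrite /= eqxx.
      case: e pk => _ -> pk.
      rewrite size_filter -(count_map fst (pred1 (p_name c))).
      rewrite (permP pk) count_uniq_mem //.
      by have /In_mem -> : In (p_name c) (map p_name cs)
        by apply/In_map; exists c.
    rewrite (_ : map fst _ = map c_name [seq k.1 | k <- defs_of T Theta]) //.
    rewrite /cocases_from; elim: (defs_of T Theta) one => //= k K IH one.
    rewrite map_cat IH; last by move=> k' k'K; apply: one; right.
    rewrite -map_comp; have := one k (or_introl erefl).
    by case: [seq _ <- _ | _] => [|x [|]].
  + move=> d e /In_map[k [<- kK]] /In_flatten[k' [k'K]].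
    case/In_map=> -[c' [b|]] [//= [ek <-]] /List.filter_In[aK /eqP /= ed].
    have ekk : k' = k.
      exact: (uniq_mapIn uK k'K kK ek).
    move: aK; rewrite {}ekk {}ed => aK.
    apply: scoped_swap.
    have /In_defs/vT[_ [Psi' [cs' [dT' _ sd]]]] := kK.
    have e' : Data T Psi' cs' = Data T Psi cs.
      by apply: (@type_names_inj _ T _ _ ut dT' dT); rewrite /= eqxx.
    by case: e' sd => _ -> /(_ c b cc aK).
- case=> dT n1 n2; have := vT _ dT.
  case: delta dT n1 n2 => //= T' s ms dT n1 n2 [ss [Psi [xs [xT pm sd]]]];
    split=> //; exists Psi, xs; split=> //.
  + apply: keep => // Psi' cs' [eT _ _]; case: (n2 s ms); by rewrite eT.
  + exact: keep.
Qed.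

Record program := Program {
  decls :> seq decl;
  program_valid : valid decls }.

(* These leave Theta unchanged when T is not a codata (resp. data) type. *)
Definition defunctionalize (T : TN) (Theta : program) : program :=
  Program (valid_defunc T (program_valid Theta)).

Definition refunctionalize (T : TN) (Theta : program) : program :=
  Program (valid_refunc T (program_valid Theta)).

Definition transform (T : TN) (Theta : program) : program :=
  if has (is_codata T) Theta then defunctionalize T Theta
  else refunctionalize T Theta.

End Language.

Arguments expr : clear implicits.
Arguments psig : clear implicits.
Arguments csig : clear implicits.
Arguments decl : clear implicits.
Arguments program : clear implicits.

(* Main.v *)
Require Import Defs.
From mathcomp Require Import all_boot.

(* Both programs declare the same signatures and have the same computation
   rules, up to the order of the two telescopes in the scope of a clause body,
   so every judgment holds in one iff it holds in the other, and it remains to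
   check that clauses stay well typed. Xi_1 and Xi_2 are closed, so theta_1 ++
   theta_2 is a unifier over Xi_1; Xi_2 iff theta_2 ++ theta_1 is one over
   Xi_2; Xi_1, provided that equality of substitutions for Psi is symmetric.
   Symmetry is not a rule: the types of the later components are instantiated
   along the left-hand side, so it requires that substituting equal
   expressions gives equal types. *)

Set Implicit Arguments.
Unset Strict Implicit.
Unset Printing Implicit Defensive.

Local Notation In := List.In.

(** * Algebra of simultaneous substitutions on expressions and telescopes *)

Section Substitution.

Context {TN CN DN : eqType}.
Local Notation expr := (expr TN CN DN).
Implicit Types (e t : expr) (s sigma Xi : seq expr) (f g : nat -> expr).

(** The usual proof that equal substitutions give equal types needs both sides of an equality to be
    typed. The right-hand side of a computation rule is an instance of a clause body, and a body is
    checked only after an mgu has been substituted into it, so typing that side amounts to subject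
    reduction. The detour is avoided because a restricted symmetry is enough: the left-hand sides
    that occur are instances of rho_1 or rho_2, which well-formed declarations type against Psi, and
    replacing equals by equals works as soon as the left-hand side is typed. The substitution and
    symmetry lemmas thus rest on validity of the program, that is on unique names and scoping, and
    take the typings of Psi, rho_1 and rho_2 as hypotheses. Both transformations are covered at once
    by a relation [dual] between a program having [T] as data and a program having it as codata. *)

Definition inst_fun sigma : nat -> expr :=
  fun i => nth (Var (i - size sigma)) (rev sigma) i.

Definition inst1_fun e : nat -> expr :=
  fun i => if i is i'.+1 then Var i' else e.

Definition upn n f : nat -> expr := iter n up f.

Lemma eq_map_In (S U : Type) (h k : S -> U) (l : seq S) :
  (forall x, In x l -> h x = k x) -> map h l = map k l.
Proof.
elim: l => //= x l IH H; rewrite H; last by left.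
by rewrite IH // => y yl; apply: H; right.
Qed.

Lemma eq_subst f g : f =1 g -> subst f =1 subst g.
Proof.
move=> fg.
elim/(@expr_nested_ind TN CN DN) => //= [T rho IH|C rho IH|e d rho -> IH];
  by rewrite (eq_map_In IH).
Qed.

Lemma eq_subst_scoped n f g e :
  scoped n e -> (forall i, i < n -> f i = g i) -> subst f e = subst g e.
Proof.
move=> + fg; elim/(@expr_nested_ind TN CN DN): e => //=.
- by move=> T rho IH /allIn sc; congr TyCon; apply: eq_map_In => x xr; auto.
- by move=> T rho IH /allIn sc; congr Pro; apply: eq_map_In => x xr; auto.
- move=> e d rho IHe IH /andP[/IHe -> /allIn sc].
  by congr Con; apply: eq_map_In => x xr; auto.
Qed.

Lemma subst_comp f g e :
  subst f (subst g e) = subst (fun i => subst f (g i)) e.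
Proof.
elim/(@expr_nested_ind TN CN DN): e => //= [T rho IH|C rho IH|e d rho -> IH];
  by rewrite -map_comp (eq_map_In IH).
Qed.

Lemma subst_Var e : subst (@Var TN CN DN) e = e.
Proof.
elim/(@expr_nested_ind TN CN DN): e => //= [T rho IH|C rho IH|e d rho -> IH];
  by rewrite (eq_map_In IH) map_id.
Qed.

Lemma subst_shift k f e : subst f (shift k e) = subst (fun i => f (k + i)) e.
Proof. exact: subst_comp. Qed.

Lemma eq_up f g : f =1 g -> up f =1 up g.
Proof. by move=> fg [|i] //=; rewrite fg. Qed.

Lemma eq_subst_tel Xi f g : f =1 g -> subst_tel f Xi = subst_tel g Xi.
Proof.
elim: Xi f g => //= t Xi IH f g fg.
by rewrite (eq_subst fg) (IH _ _ (eq_up fg)).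
Qed.

Lemma subst_up f g i : subst (up f) (up g i) = up (fun i => subst f (g i)) i.
Proof. by case: i => //= i; rewrite subst_shift /shift subst_comp. Qed.

Lemma subst_tel_comp f g Xi :
  subst_tel f (subst_tel g Xi) = subst_tel (fun i => subst f (g i)) Xi.
Proof.
elim: Xi f g => //= t Xi IH f g; rewrite subst_comp IH.
by congr cons; apply: eq_subst_tel => i; exact: subst_up.
Qed.

Lemma subst_tel_inst_tel f e Xi :
  subst_tel f (inst_tel e Xi) = inst_tel (subst f e) (subst_tel (up f) Xi).
Proof.
rewrite /inst_tel !subst_tel_comp; apply: eq_subst_tel => -[|i] //=.
by rewrite subst_shift subst_Var.
Qed.

Lemma subst_tel_cat f Xi1 Xi2 :
  subst_tel f (Xi1 ++ Xi2) =
  subst_tel f Xi1 ++ subst_tel (upn (size Xi1) f) Xi2.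
Proof. by elim: Xi1 f => //= t Xi IH f; rewrite IH /upn -iterSr. Qed.

Lemma size_subst_tel f Xi : size (subst_tel f Xi) = size Xi.
Proof. by elim: Xi f => //= t Xi IH f; rewrite IH. Qed.

Lemma subst_tel_scoped n f Xi :
  tel_scoped n Xi -> (forall i, i < n -> f i = Var i) -> subst_tel f Xi = Xi.
Proof.
elim: Xi n f => //= t Xi IH n f /andP[st sX] fV.
rewrite (eq_subst_scoped st fV) subst_Var (IH n.+1) // => -[|i] //= lt_in.
by rewrite fV.
Qed.

Lemma subst_tel_Var Xi : subst_tel (@Var TN CN DN) Xi = Xi.
Proof.
elim: Xi => //= t Xi IH; rewrite subst_Var; congr cons.
by rewrite -[RHS]IH; apply: eq_subst_tel => -[].
Qed.

Lemma subst_tel_closed f Xi : tel_scoped 0 Xi -> subst_tel f Xi = Xi.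
Proof. by move/subst_tel_scoped; apply. Qed.

Lemma upn_ge n f i : upn n f (n + i) = shift n (f i).
Proof.
elim: n => [|n IH] /=; first by rewrite /shift subst_Var.
by rewrite -/(upn n f) IH /shift subst_comp.
Qed.

Lemma upn_lt n f i : i < n -> upn n f i = Var i.
Proof. by elim: n i => // n IH [|i] //= lt_in; rewrite -/(upn n f) IH. Qed.

Lemma inst_fun_ge sigma i : inst_fun sigma (size sigma + i) = Var i.
Proof. by rewrite /inst_fun nth_default ?size_rev ?leq_addr // addKn. Qed.

Lemma inst_fun_cat s1 s2 i :
  inst_fun (s1 ++ s2) (size s2 + i) = inst_fun s1 i.
Proof.
rewrite /inst_fun rev_cat nth_cat size_rev ltnNge leq_addr /= addKn size_cat.
by rewrite addnC subnDr.
Qed.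

Lemma inst_fun_cat_lt s1 s2 i :
  i < size s2 -> inst_fun (s1 ++ s2) i = inst_fun s2 i.
Proof.
move=> lt_i; rewrite /inst_fun rev_cat nth_cat size_rev lt_i.
by apply: set_nth_default; rewrite size_rev.
Qed.

(** The rules for substitutions instantiate a telescope one entry at a time, from the left; this
    identifies the result with a single simultaneous substitution. The first entry [e] is moved
    under the remaining variables, and [s] then cancels that shift. *)
Lemma inst_fun_cons e s i :
  subst (inst_fun s) (upn (size s) (inst1_fun e) i) = inst_fun (e :: s) i.
Proof.
case: (ltnP i (size s)) => [lt_i|le_i].
  by rewrite upn_lt // -cat1s inst_fun_cat_lt.
rewrite -(subnKC le_i) upn_ge subst_shift -cat1s inst_fun_cat.
(* Beyond its own length [inst_fun s] only returns outer variables, so on a shifted expression it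
   undoes the shift. *)
transitivity (subst (@Var TN CN DN) (inst1_fun e (i - size s))).
  by apply: eq_subst => j; exact: inst_fun_ge.
rewrite subst_Var; case: (i - _) => //= j.
by rewrite /inst_fun /= nth_nil subn1.
Qed.

Lemma subst_tel_inst_nil Xi : subst_tel (inst_fun [::]) Xi = Xi.
Proof.
rewrite -[RHS]subst_tel_Var; apply: eq_subst_tel => i.
by rewrite /inst_fun nth_nil subn0.
Qed.

Lemma subst_tel_inst_cons e s Xi :
  subst_tel (inst_fun s) (subst_tel (upn (size s) (inst1_fun e)) Xi) =
  subst_tel (inst_fun (e :: s)) Xi.
Proof.
by rewrite subst_tel_comp; apply: eq_subst_tel => i; exact: inst_fun_cons.
Qed.

Lemma inst_tel_cat e Xi1 Xi2 :
  inst_tel e (Xi1 ++ Xi2) =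
  inst_tel e Xi1 ++ subst_tel (upn (size Xi1) (inst1_fun e)) Xi2.
Proof. exact: subst_tel_cat. Qed.

Lemma inst_rcons_shift s e k t :
  inst (rcons s e) (shift k.+1 t) = inst s (shift k t).
Proof.
rewrite /inst !subst_shift; apply: eq_subst => i.
by rewrite -cats1; exact: (inst_fun_cat s [:: e]).
Qed.

(** Scoping is essential: at an index beyond [size sigma] the left side would apply [f] to an outer
    variable that the right side leaves alone. *)
Lemma subst_inst f sigma e :
  scoped (size sigma) e ->
  subst f (inst sigma e) = inst (map (subst f) sigma) e.
Proof.
move=> sc; rewrite /inst subst_comp; apply: eq_subst_scoped sc _ => i lt_i.
by rewrite -map_rev (nth_map (Var (i - size sigma))) ?size_rev.
Qed.

Lemma map_subst_insts f sigma s :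
  all (scoped (size sigma)) s ->
  map (subst f) (insts sigma s) = insts (map (subst f) sigma) s.
Proof.
move=> /allIn sc; rewrite -map_comp; apply: eq_map_In => e es /=.
by rewrite subst_inst ?sc.
Qed.

Lemma insts_shift s1 s2 s :
  insts (s1 ++ s2) (map (shift (size s2)) s) = insts s1 s.
Proof.
rewrite /insts -map_comp; apply: eq_map => e /=.
by rewrite /inst subst_shift; apply: eq_subst => i; exact: inst_fun_cat.
Qed.

Lemma insts_cat_scoped s1 s2 s :
  all (scoped (size s2)) s -> insts (s1 ++ s2) s = insts s2 s.
Proof.
move=> /allIn sc; apply: eq_map_In => e /sc se.
by apply: eq_subst_scoped se _ => i; exact: inst_fun_cat_lt.
Qed.

Lemma size_ids k n : size (ids k n : seq expr) = n.
Proof. by rewrite size_rev size_map size_iota. Qed.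

(** Stated for three blocks so as to cover both id_{Xi_1} (empty [s1]) and id_{Xi_2} (empty [s3]) in
    the scope of a clause. *)
Lemma insts_ids s1 s2 s3 :
  insts (s1 ++ s2 ++ s3) (ids (size s3) (size s2)) = s2.
Proof.
rewrite /insts /ids map_rev -map_comp -[RHS]revK; congr rev.
apply: (@eq_from_nth _ (Var 0)) => [|i];
  rewrite size_map size_iota ?size_rev //.
move=> lt_i; rewrite (nth_map 0) ?size_iota // nth_iota // catA.
rewrite /inst /= -/(inst_fun _ _) inst_fun_cat inst_fun_cat_lt //.
by apply: set_nth_default; rewrite size_rev.
Qed.

(** Both sides send each variable to the same component. The bound matters because [swap] does not
    treat larger indices as outer variables. *)
Lemma inst_swap s1 s2 e : scoped (size s1 + size s2) e ->
  inst (s2 ++ s1) (swap (size s1) (size s2) e) = inst (s1 ++ s2) e.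
Proof.
move=> sc; rewrite /inst /swap subst_comp.
apply: eq_subst_scoped sc _ => i lt_i.
rewrite /= -!/(inst_fun _ _); case: ltnP => hi.
  by rewrite inst_fun_cat inst_fun_cat_lt.
rewrite inst_fun_cat_lt; first by rewrite -{2}(subnKC hi) inst_fun_cat.
by rewrite ltn_subLR // addnC.
Qed.

Lemma swapK n1 n2 e : scoped (n1 + n2) e -> swap n2 n1 (swap n1 n2 e) = e.
Proof.
move=> sc; rewrite /swap subst_comp -[RHS]subst_Var.
apply: eq_subst_scoped sc _ => i lt_i /=; case: (ltnP i n2) => hi.
  by rewrite ltnNge leq_addr /= addKn.
by rewrite ltn_subLR // addnC lt_i subnKC.
Qed.

End Substitution.

(* Mutual induction on the judgments; names determine their declarations *)
Scheme ctx_ok_mut := Minimality for ctx_ok Sort Prop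
with tel_ok_mut := Minimality for tel_ok Sort Prop
with has_types_mut := Minimality for has_types Sort Prop
with eq_exprs_mut := Minimality for eq_exprs Sort Prop
with has_type_mut := Minimality for has_type Sort Prop
with eq_expr_mut := Minimality for eq_expr Sort Prop.
Combined Scheme judgments_mutind from ctx_ok_mut, tel_ok_mut, has_types_mut,
  eq_exprs_mut, has_type_mut, eq_expr_mut.

Section Names.

Context {TN CN DN : eqType}.
Variable Theta : seq (decl TN CN DN).
Hypothesis Theta_valid : valid Theta.

(** Used with [producer_names] and [consumer_names]: a name determines the declaration that
    introduces it. *)
Lemma uniq_flatten_inj (S : Type) (U : eqType) (h : S -> seq U) (l : seq S) :
  uniq (flatten (map h l)) -> forall x y z, In x l -> In y l ->
  z \in h x -> z \in h y -> x = y.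
Proof.
elim: l => //= a l IH; rewrite cat_uniq => /and3P[_ /hasPn dis /IH {}IH] x y z.
have excl b : In b l -> z \in h b -> z \in h a -> False.
  move=> bl zb za; suff /dis/negP : z \in flatten (map h l) by apply.
  by apply/In_mem/In_flatten; exists b; split=> //; apply/In_mem.
move=> [<-|xl] [<-|yl] // zx zy.
- by case: (excl y).
- by case: (excl x).
- exact: IH zx zy.
Qed.

(** A typed [Pro] carries only a name; this recovers the signature from it, and so makes types
    unique. *)
Lemma producer_inj T T' s s' :
  is_producer Theta T s -> is_producer Theta T' s' -> p_name s = p_name s' ->
  T = T' /\ s = s'.
Proof.
have [_ up_ _ _] := Theta_valid.
have inj := uniq_flatten_inj up_.
case=> [[Psi [cs [dT sc]]]|[os dT]] [[Psi' [cs' [dT' sc']]]|[os' dT']] es.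
- have ms : p_name s \in map p_name cs by apply/In_mem/In_map; exists s.
  have ms' : p_name s \in map p_name cs'.
    by rewrite es; apply/In_mem/In_map; exists s'.
  have [eT _ ecs] := inj _ _ _ dT dT' ms ms'; rewrite -{}ecs in sc'.
  split=> //.
  exact: (uniq_mapIn (uniq_flattenIn up_ dT) sc sc').
- have := inj _ _ (p_name s) dT dT'.
  suff -> : p_name s \in map p_name cs
    by rewrite /= inE es eqxx => /(_ isT isT).
  by apply/In_mem/In_map; exists s.
- have := inj _ _ (p_name s) dT dT'.
  suff -> : p_name s \in map p_name cs' by rewrite /= inE eqxx => /(_ isT isT).
  by apply/In_mem/In_map; exists s'.
- have := inj _ _ (p_name s) dT dT'.
  by rewrite /= !inE -es eqxx => /(_ isT isT)[-> ->].
Qed.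

Lemma consumer_inj T T' s s' :
  is_consumer Theta T s -> is_consumer Theta T' s' -> c_name s = c_name s' ->
  T = T' /\ s = s'.
Proof.
have [_ _ uc _] := Theta_valid.
have inj := uniq_flatten_inj uc.
case=> [[os dT]|[Psi [ds [dT sd]]]] [[os' dT']|[Psi' [ds' [dT' sd']]]] es.
- have := inj _ _ (c_name s) dT dT'.
  by rewrite /= !inE -es eqxx => /(_ isT isT)[-> ->].
- have := inj _ _ (c_name s) dT dT'.
  suff -> : c_name s \in map c_name ds' by rewrite /= inE eqxx => /(_ isT isT).
  by apply/In_mem/In_map; exists s'.
- have := inj _ _ (c_name s) dT dT'.
  suff -> : c_name s \in map c_name ds
    by rewrite /= inE es eqxx => /(_ isT isT).
  by apply/In_mem/In_map; exists s.
- have ms : c_name s \in map c_name ds by apply/In_mem/In_map; exists s.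
  have ms' : c_name s \in map c_name ds'.
    by rewrite es; apply/In_mem/In_map; exists s'.
  have [eT _ eds] := inj _ _ _ dT dT' ms ms'; rewrite -{}eds in sd'.
  split=> //.
  exact: (uniq_mapIn (uniq_flattenIn uc dT) sd sd').
Qed.

Lemma Data_inj T Psi Psi' cs cs' :
  In (Data T Psi cs) Theta -> In (Data T Psi' cs') Theta ->
  Psi = Psi' /\ cs = cs'.
Proof.
have [ut _ _ _] := Theta_valid => dT dT'.
by have := type_names_inj (T := T) ut dT dT'; rewrite /= eqxx => /(_ isT isT)[].
Qed.

Lemma Codata_inj T Psi Psi' ds ds' :
  In (Codata T Psi ds) Theta -> In (Codata T Psi' ds') Theta ->
  Psi = Psi' /\ ds = ds'.
Proof.
have [ut _ _ _] := Theta_valid => dT dT'.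
by have := type_names_inj (T := T) ut dT dT'; rewrite /= eqxx => /(_ isT isT)[].
Qed.

Lemma Data_Codata T Psi Psi' cs ds :
  In (Data T Psi cs) Theta -> In (Codata T Psi' ds) Theta -> False.
Proof.
have [ut _ _ _] := Theta_valid => dT dT'.
by have := type_names_inj (T := T) ut dT dT'; rewrite /= eqxx => /(_ isT isT).
Qed.

Lemma is_type_scoped T Psi : is_type Theta T Psi -> tel_scoped 0 Psi.
Proof. by have [_ _ _ vT] := Theta_valid => -[] [? /vT/= /andP[]]. Qed.

Lemma is_producer_scoped T s : is_producer Theta T s -> psig_scoped s.
Proof.
have [_ _ _ vT] := Theta_valid.
by case=> [[Psi [cs [/vT/= /andP[_ /allIn sc] /sc]]]|[os /vT[]]].
Qed.

Lemma is_consumer_scoped T s : is_consumer Theta T s -> csig_scoped s.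
Proof.
have [_ _ _ vT] := Theta_valid.
by case=> [[os /vT[]]|[Psi [cs [/vT/= /andP[_ /allIn sc] /sc]]]].
Qed.

Lemma case_scoped T Psi cs c d cases e :
  In (Data T Psi cs) Theta -> In c cs -> In (Def T d cases) Theta ->
  In (p_name c, Some e) cases -> scoped (size (c_tel d) + size (p_tel c)) e.
Proof.
have [_ _ _ vT] := Theta_valid => dT cc /vT[_ [Psi' [cs' [dT' _ sc]]]].
by have [_ ecs] := Data_inj dT dT'; apply: sc; rewrite -ecs.
Qed.

Lemma cocase_scoped T Psi ds c d cocases e :
  In (Codata T Psi ds) Theta -> In d ds -> In (Codef T c cocases) Theta ->
  In (c_name d, Some e) cocases -> scoped (size (p_tel c) + size (c_tel d)) e.
Proof.
have [_ _ _ vT] := Theta_valid => dT cc /vT[_ [Psi' [ds' [dT' _ sc]]]].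
by have [_ eds] := Codata_inj dT dT'; apply: sc; rewrite -eds.
Qed.

End Names.

(** * Substitution lemma, uniqueness of types, symmetry of substitution equality, exchange of
    telescopes *)

Section Metatheory.

Context {TN CN DN : eqType}.
Variable Theta : seq (decl TN CN DN).
Hypothesis Theta_valid : valid Theta.
Local Notation expr := (expr TN CN DN).
Local Notation has_type := (has_type Theta).
Local Notation has_types := (has_types Theta).
Local Notation eq_expr := (eq_expr Theta).
Local Notation eq_exprs := (eq_exprs Theta).
Local Notation ctx_ok := (ctx_ok Theta).
Local Notation tel_ok := (tel_ok Theta).
Implicit Types (e t A B : expr) (Gamma Delta Xi sigma theta : seq expr).

Lemma judgments_ctx :
  (forall Gamma, ctx_ok Gamma -> ctx_ok Gamma) /\
  (forall Gamma Xi, tel_ok Gamma Xi -> ctx_ok Gamma) /\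
  (forall Gamma sigma Xi, has_types Gamma sigma Xi -> ctx_ok Gamma) /\
  (forall Gamma sigma sigma' Xi, eq_exprs Gamma sigma sigma' Xi ->
    ctx_ok Gamma) /\
  (forall Gamma e t, has_type Gamma e t -> ctx_ok Gamma) /\
  (forall Gamma e e' t, eq_expr Gamma e e' t -> ctx_ok Gamma).
Proof.
apply: judgments_mutind => //; first exact: ctx_nil.
by move=> G t okG _ tt _; exact: ctx_rcons.
Qed.

Lemma has_types_ctx Gamma sigma Xi : has_types Gamma sigma Xi -> ctx_ok Gamma.
Proof. by have [_ [_ [H _]]] := judgments_ctx; exact: H. Qed.

Lemma eq_exprs_ctx Gamma sigma sigma' Xi :
  eq_exprs Gamma sigma sigma' Xi -> ctx_ok Gamma.
Proof. by have [_ [_ [_ [H _]]]] := judgments_ctx; exact: H. Qed.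

Lemma ctx_ok_rcons Gamma t :
  ctx_ok (rcons Gamma t) -> ctx_ok Gamma /\ has_type Gamma t Typ.
Proof.
move=> H; inversion H as [E|G t' okG tt E]; first by case: (Gamma) E.
by case/rcons_inj: E => <- <-.
Qed.

Lemma tel_ok_ctx Gamma Xi : tel_ok Gamma Xi -> ctx_ok (Gamma ++ Xi).
Proof.
by elim=> [G okG|G t X tt _]; rewrite ?cats0 // cat_rcons.
Qed.

Lemma ctx_ok_cat Gamma Xi : ctx_ok (Gamma ++ Xi) -> ctx_ok Gamma.
Proof.
elim/last_ind: Xi => [|Xi t IH]; first by rewrite cats0.
by rewrite -rcons_cat => /ctx_ok_rcons[/IH].
Qed.

Lemma ctx_ok_tel Gamma Xi : ctx_ok (Gamma ++ Xi) -> tel_ok Gamma Xi.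
Proof.
elim: Xi Gamma => [|t Xi IH] G; first by rewrite cats0; exact: tel_nil.
rewrite -cat_rcons => ok; apply: tel_cons; last exact: IH.
by have /ctx_ok_rcons[] := ctx_ok_cat ok.
Qed.

Lemma has_types_size Gamma sigma Xi :
  has_types Gamma sigma Xi -> size sigma = size Xi.
Proof. by elim=> //= G e s t X _ _ ->; rewrite size_subst_tel. Qed.

Lemma eq_exprs_size Gamma sigma sigma' Xi : eq_exprs Gamma sigma sigma' Xi ->
  size sigma = size Xi /\ size sigma' = size Xi.
Proof. by elim=> //= G e e' s s' t X _ _ [-> ->]; rewrite size_subst_tel. Qed.


Lemma has_types_consE Gamma e sigma t Xi :
  has_types Gamma (e :: sigma) (t :: Xi) <->
  has_type Gamma e t /\ has_types Gamma sigma (inst_tel e Xi).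
Proof. by split=> [H|[]]; [inversion H | exact: types_cons]. Qed.

Lemma eq_exprs_consE Gamma e e' sigma sigma' t Xi :
  eq_exprs Gamma (e :: sigma) (e' :: sigma') (t :: Xi) <->
  eq_expr Gamma e e' t /\ eq_exprs Gamma sigma sigma' (inst_tel e Xi).
Proof. by split=> [H|[]]; [inversion H | exact: eqs_cons]. Qed.

(** The successive instantiations of [Xi2] by the entries of [s1] collapse into one by
    [subst_tel_inst_cons]; for closed [Xi2] they vanish altogether. *)
Lemma has_types_cat Gamma s1 s2 Xi1 Xi2 : size s1 = size Xi1 ->
  has_types Gamma (s1 ++ s2) (Xi1 ++ Xi2) <->
  has_types Gamma s1 Xi1 /\ has_types Gamma s2 (subst_tel (inst_fun s1) Xi2).
Proof.
elim: s1 Xi1 Xi2 => [|e s1 IH] [|t Xi1] Xi2 //=.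
  rewrite subst_tel_inst_nil => _; split=> [H|[]//]; split=> //.
  by apply: types_nil; exact: has_types_ctx H.
case=> sz; rewrite !has_types_consE inst_tel_cat -sz IH ?size_subst_tel //.
by rewrite subst_tel_inst_cons; split=> [[? []]|[[]]].
Qed.

Lemma eq_exprs_cat Gamma s1 s1' s2 s2' Xi1 Xi2 :
  size s1 = size Xi1 -> size s1' = size Xi1 ->
  eq_exprs Gamma (s1 ++ s2) (s1' ++ s2') (Xi1 ++ Xi2) <->
  eq_exprs Gamma s1 s1' Xi1 /\
  eq_exprs Gamma s2 s2' (subst_tel (inst_fun s1) Xi2).
Proof.
elim: s1 s1' Xi1 Xi2 => [|e s1 IH] [|e' s1'] [|t Xi1] Xi2 //=.
  rewrite subst_tel_inst_nil => _ _; split=> [H|[]//]; split=> //.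
  by apply: eqs_nil; exact: eq_exprs_ctx H.
case=> sz [sz'].
rewrite !eq_exprs_consE inst_tel_cat -sz IH ?size_subst_tel //.
by rewrite subst_tel_inst_cons; split=> [[? []]|[[]]].
Qed.

(** Substitutions are built from the left while contexts grow on the right; this permits induction
    from the right, as needed for variables and for symmetry. *)
Lemma has_types_rcons Gamma s e Xi t :
  has_types Gamma (rcons s e) (rcons Xi t) <->
  has_types Gamma s Xi /\ has_type Gamma e (inst s t).
Proof.
split=> [H|[H He]].
  have /eqP := has_types_size H; rewrite !size_rcons eqSS => /eqP sz.
  move: H; rewrite -!cats1 has_types_cat //= => -[H1 H2]; split=> //.
  by move: H2; rewrite has_types_consE => -[].
rewrite -!cats1 has_types_cat ?(has_types_size H) //; split=> //=.
by apply/has_types_consE; split=> //; apply: types_nil; exact: has_types_ctx H.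
Qed.

Lemma eq_exprs_rcons Gamma s s' e e' Xi t :
  eq_exprs Gamma (rcons s e) (rcons s' e') (rcons Xi t) <->
  eq_exprs Gamma s s' Xi /\ eq_expr Gamma e e' (inst s t).
Proof.
split=> [H|[H He]].
  have [] := eq_exprs_size H; rewrite !size_rcons => -[sz] [sz'].
  move: H; rewrite -!cats1 eq_exprs_cat //= => -[H1 H2]; split=> //.
  by move: H2; rewrite eq_exprs_consE => -[].
have [sz sz'] := eq_exprs_size H; rewrite -!cats1 eq_exprs_cat //; split=> //=.
by apply/eq_exprs_consE; split=> //; apply: eqs_nil; exact: eq_exprs_ctx H.
Qed.

Lemma has_types_nth Delta theta Gamma i :
  has_types Delta theta Gamma -> i < size Gamma ->
  has_type Delta (inst_fun theta i)
    (inst theta (shift i.+1 (nth Typ (rev Gamma) i))).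
Proof.
elim/last_ind: Gamma theta i => // Gamma t IH theta i; rewrite size_rcons.
case/lastP: theta => [|theta e] H.
  by have := has_types_size H; rewrite size_rcons.
move: H; rewrite has_types_rcons inst_rcons_shift rev_rcons => -[H He].
case: i => [_|i lt_i] /=.
  by rewrite /inst_fun rev_rcons /= /shift subst_Var.
by rewrite -cats1 (inst_fun_cat theta [:: e]); exact: IH.
Qed.

Lemma inst_judgments :
  (forall Gamma, ctx_ok Gamma -> True) /\
  (forall Gamma Xi, tel_ok Gamma Xi -> True) /\
  (forall Gamma sigma Xi, has_types Gamma sigma Xi ->
    forall Delta theta, has_types Delta theta Gamma ->
    has_types Delta (insts theta sigma) (subst_tel (inst_fun theta) Xi)) /\
  (forall Gamma sigma sigma' Xi, eq_exprs Gamma sigma sigma' Xi ->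
    forall Delta theta, has_types Delta theta Gamma ->
    eq_exprs Delta (insts theta sigma) (insts theta sigma')
      (subst_tel (inst_fun theta) Xi)) /\
  (forall Gamma e t, has_type Gamma e t ->
    forall Delta theta, has_types Delta theta Gamma ->
    has_type Delta (inst theta e) (inst theta t)) /\
  (forall Gamma e e' t, eq_expr Gamma e e' t ->
    forall Delta theta, has_types Delta theta Gamma ->
    eq_expr Delta (inst theta e) (inst theta e') (inst theta t)).
Proof.
apply: judgments_mutind => //.
- by move=> G _ _ D th H; apply: types_nil; exact: has_types_ctx H.
- move=> G e s t X _ IHe _ IHs D th H; apply: types_cons; first exact: IHe.
  by have := IHs D th H; rewrite subst_tel_inst_tel.
- by move=> G _ _ D th H; apply: eqs_nil; exact: has_types_ctx H.
- move=> G e e' s s' t X _ IHe _ IHs D th H; apply: eqs_cons; first exact: IHe.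
  by have := IHs D th H; rewrite subst_tel_inst_tel.
- by move=> G i _ _ lt_i D th H; exact: has_types_nth.
- by move=> G _ _ D th H; apply: type_typ; exact: has_types_ctx H.
- by move=> G e t t' _ IHe _ IHt D th H;
    apply: type_conv (IHe _ _ H) (IHt _ _ H).
- move=> G T Psi rho tT _ IH D th H; apply: (type_tycon tT).
  by have := IH D th H; rewrite subst_tel_closed // (is_type_scoped _ tT).
- move=> G T s sigma ps sz IH D th H.
  (* A closed telescope is unaffected by [theta], and indices in its scope let [theta] pass into
     [sigma]. *)
  have /andP[cl sc] := is_producer_scoped Theta_valid ps.
  have {}IH := IH D th H; rewrite subst_tel_closed // in IH.
  rewrite /inst /= map_subst_insts ?(has_types_size sz) //.
  exact: type_pro ps IH.
- move=> G T s e sigma cs sz IH _ IHe D th H.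
  have /and3P[cl sc st] := is_consumer_scoped Theta_valid cs.
  have {}IH := IH D th H; rewrite subst_tel_closed // in IH.
  have {}IHe := IHe D th H; rewrite /inst /= map_subst_insts in IHe; last first.
    by rewrite (has_types_size sz).
  rewrite /inst /= subst_inst ?size_rcons ?(has_types_size sz) // map_rcons.
  exact: type_con cs IH IHe.
- by move=> G e t _ IH D th H; apply: eqe_refl; exact: IH.
- by move=> G e e' t _ IH D th H; apply: eqe_sym; exact: IH.
- move=> G e e' e'' t _ IH _ IH' D th H.
  exact: eqe_trans (IH _ _ H) (IH' _ _ H).
- move=> G e e' t t' _ IH _ IH' D th H.
  exact: eqe_conv (IH _ _ H) (IH' _ _ H).
- move=> G T Psi rho rho' tT _ IH D th H; apply: (eqe_tycon tT).
  by have := IH D th H; rewrite subst_tel_closed // (is_type_scoped _ tT).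
- move=> G T s sigma sigma' ps sz IH D th H.
  have /andP[cl sc] := is_producer_scoped Theta_valid ps.
  have {}IH := IH D th H; rewrite subst_tel_closed // in IH.
  rewrite /inst /= map_subst_insts ?(eq_exprs_size sz).1 //.
  exact: eqe_pro ps IH.
- move=> G T s e e' sigma sigma' cs sz IH _ IHe D th H.
  have /and3P[cl sc st] := is_consumer_scoped Theta_valid cs.
  have {}IH := IH D th H; rewrite subst_tel_closed // in IH.
  have {}IHe := IHe D th H; rewrite /inst /= map_subst_insts in IHe; last first.
    by rewrite (eq_exprs_size sz).1.
  rewrite /inst /= subst_inst ?size_rcons ?(eq_exprs_size sz).1 // map_rcons.
  exact: eqe_con cs IH IHe.
- move=> G T Psi cs c d cases e s1 s2 dT cc dd ec sz1 IH1 sz2 IH2 _ IH D th H.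
  have pc : is_producer Theta T c by left; exists Psi, cs.
  have cd : is_consumer Theta T d by left; exists cases.
  have /andP[cl1 sc1] := is_producer_scoped Theta_valid pc.
  have /and3P[cl2 sc2 st] := is_consumer_scoped Theta_valid cd.
  have clP : tel_scoped 0 Psi.
    by apply: (is_type_scoped Theta_valid (T := T)); left; exists cs.
  have {}IH1 := IH1 D th H; rewrite subst_tel_closed // in IH1.
  have {}IH2 := IH2 D th H; rewrite subst_tel_closed // in IH2.
  have {}IH := IH D th H; rewrite subst_tel_closed // in IH.
  rewrite [insts th _]map_subst_insts ?(has_types_size sz1) // in IH.
  rewrite [insts th _]map_subst_insts ?(has_types_size sz2) // in IH.
  have se := case_scoped Theta_valid dT cc dd ec.
  rewrite /inst /= !subst_inst ?size_rcons ?size_cat ?(has_types_size sz1)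
    ?(has_types_size sz2) // map_rcons map_cat.
  exact: eqe_data dT cc dd ec IH1 IH2 IH.
- move=> G T Psi ds c d cocases e s1 s2 dT dd cc ec sz1 IH1 sz2 IH2 _ IH D th H.
  have pc : is_producer Theta T c by right; exists cocases.
  have cd : is_consumer Theta T d by right; exists Psi, ds.
  have /andP[cl1 sc1] := is_producer_scoped Theta_valid pc.
  have /and3P[cl2 sc2 st] := is_consumer_scoped Theta_valid cd.
  have clP : tel_scoped 0 Psi.
    by apply: (is_type_scoped Theta_valid (T := T)); right; exists ds.
  have {}IH1 := IH1 D th H; rewrite subst_tel_closed // in IH1.
  have {}IH2 := IH2 D th H; rewrite subst_tel_closed // in IH2.
  have {}IH := IH D th H; rewrite subst_tel_closed // in IH.
  rewrite [insts th _]map_subst_insts ?(has_types_size sz1) // in IH.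
  rewrite [insts th _]map_subst_insts ?(has_types_size sz2) // in IH.
  have se := cocase_scoped Theta_valid dT dd cc ec.
  rewrite /inst /= !subst_inst ?size_rcons ?size_cat ?(has_types_size sz1)
    ?(has_types_size sz2) // map_rcons map_cat.
  exact: eqe_codata dT dd cc ec IH1 IH2 IH.
Qed.

Lemma has_types_inst Gamma sigma Xi Delta theta :
  has_types Gamma sigma Xi -> tel_scoped 0 Xi -> has_types Delta theta Gamma ->
  has_types Delta (insts theta sigma) Xi.
Proof.
have [_ [_ [H _]]] := inst_judgments => /H{}H cl /H.
by rewrite subst_tel_closed.
Qed.

Lemma has_type_inst Gamma e t Delta theta :
  has_type Gamma e t -> has_types Delta theta Gamma ->
  has_type Delta (inst theta e) (inst theta t).
Proof. by have [_ [_ [_ [_ [H _]]]]] := inst_judgments => /H{}H /H. Qed.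

(** Identity is a separate alternative because reflexivity of the judgment would require [A] to have
    type [Typ], which is not known for the type of an arbitrary typed expression. *)
Definition type_eq Gamma A B : Prop := A = B \/ eq_expr Gamma A B Typ.

Lemma type_eq_sym Gamma A B : type_eq Gamma A B -> type_eq Gamma B A.
Proof. by case=> [->|/eqe_sym]; [left|right]. Qed.

Lemma type_eq_trans Gamma A B C :
  type_eq Gamma A B -> type_eq Gamma B C -> type_eq Gamma A C.
Proof.
case=> [-> //|AB] [<-|BC]; right=> //; exact: eqe_trans AB BC.
Qed.

Lemma eq_expr_type_eq Gamma e e' A B :
  eq_expr Gamma e e' A -> type_eq Gamma A B -> eq_expr Gamma e e' B.
Proof. by move=> ee [<- //|]; exact: eqe_conv. Qed.

Lemma has_type_inv Gamma e A : has_type Gamma e A ->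
  match e with
  | Var i => type_eq Gamma (shift i.+1 (nth Typ (rev Gamma) i)) A
  | Typ => type_eq Gamma Typ A
  | TyCon T rho =>
      (exists Psi, is_type Theta T Psi /\ has_types Gamma rho Psi) /\
      type_eq Gamma Typ A
  | Pro C sigma => exists T s,
      [/\ is_producer Theta T s, p_name s = C, has_types Gamma sigma (p_tel s)
        & type_eq Gamma (TyCon T (insts sigma (p_ix s))) A]
  | Con e d sigma => exists T s,
      [/\ is_consumer Theta T s, c_name s = d, has_types Gamma sigma (c_tel s),
          has_type Gamma e (TyCon T (insts sigma (c_ix s)))
        & type_eq Gamma (inst (rcons sigma e) (c_type s)) A]
  end.
Proof.
elim=> {Gamma e A}; try by intros; left.
- move=> G e A B _ + AB.
  have tr t : type_eq G t A -> type_eq G t B.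
    by move/type_eq_trans; apply; right.
  case: e => [i|//|T rho|C s|e d s]; try exact: tr.
  + by case=> ? /tr.
  + by case=> T [s' [? ? ? /tr]]; exists T, s'.
  + by case=> T [s' [? ? ? ? /tr]]; exists T, s'.
- by move=> G T Psi rho tT sz; split; [exists Psi|left].
- by move=> G T s sigma ps sz; exists T, s; split=> //; left.
- by move=> G T s e sigma cs sz He _; exists T, s; split=> //; left.
Qed.

Lemma has_type_unique Gamma e A B :
  has_type Gamma e A -> has_type Gamma e B -> type_eq Gamma A B.
Proof.
move=> /has_type_inv + /has_type_inv.
have tr t : type_eq Gamma t A -> type_eq Gamma t B -> type_eq Gamma A B.
  by move/type_eq_sym; exact: type_eq_trans.
case: e => [i|//|T rho|C s|e d s]; try exact: tr.
- by case=> _ hA [_ /(tr _ hA)].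
- move=> [T [c [pc <- _ hA]]] [T' [c' [pc' ec _ hB]]].
  have [eT e] := producer_inj Theta_valid pc' pc ec.
  by rewrite eT e in hB; exact: tr hA hB.
- move=> [T [c [pc <- _ _ hA]]] [T' [c' [pc' ec _ _ hB]]].
  have [eT e'] := consumer_inj Theta_valid pc' pc ec.
  by rewrite e' in hB; exact: tr hA hB.
Qed.

(** Outer variables are mapped identically and need no typing; where the values differ, the left one
    is typed, so that uniqueness of types can adjust the type of the equation. *)
Definition eq_funs Gamma (f g : nat -> expr) : Prop :=
  forall i, f i = g i \/
    exists B, has_type Gamma (f i) B /\ eq_expr Gamma (f i) (g i) B.

(* By induction on the expression rather than on the typing derivation: the
   inverted typing rule supplies the premises of the congruence rule along the
   left-hand side, and unique types handle the variables, so that neither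
   subject reduction nor the typing of the right-hand side is needed. *)
Lemma eq_subst_expr Gamma f g e A : eq_funs Gamma f g ->
  has_type Gamma (subst f e) A -> eq_expr Gamma (subst f e) (subst g e) A.
Proof.
move=> fg; have list s Xi :
    (forall e, In e s -> forall A, has_type Gamma (subst f e) A ->
      eq_expr Gamma (subst f e) (subst g e) A) ->
    has_types Gamma (map (subst f) s) Xi ->
    eq_exprs Gamma (map (subst f) s) (map (subst g) s) Xi.
  elim: s Xi => [|x s IHs] [|t Xi] IH H; have okG := has_types_ctx H.
  - exact: eqs_nil.
  - by have := has_types_size H.
  - by have := has_types_size H.
  move: H => /= /has_types_consE[Hx Hs]; apply: eqs_cons.
    by apply: IH => //; left.
  by apply: IHs => // y ys; apply: IH; right.
elim/(@expr_nested_ind TN CN DN): e A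
  => [i|A|T rho IH A|C s IH A|e d s IHe IH A].
- move=> A /= H; case: (fg i) => [<-|[B [HB eB]]]; first exact: eqe_refl.
  exact: eq_expr_type_eq eB (has_type_unique HB H).
- exact: eqe_refl.
- move=> /has_type_inv[[Psi [tT /(list _ _ IH) H]] hA].
  exact: eq_expr_type_eq (eqe_tycon tT H) hA.
- move=> /has_type_inv[T [c [pc <- /(list _ _ IH) H hA]]].
  exact: eq_expr_type_eq (eqe_pro pc H) hA.
- move=> /has_type_inv[T [c [pc <- /(list _ _ IH) H He hA]]].
  exact: eq_expr_type_eq (eqe_con pc H (IHe _ He)) hA.
Qed.

Lemma eq_exprs_funs Gamma sigma sigma' Xi :
  eq_exprs Gamma sigma sigma' Xi -> has_types Gamma sigma Xi ->
  eq_funs Gamma (inst_fun sigma) (inst_fun sigma').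
Proof.
elim=> {Gamma sigma sigma' Xi} [*|G e e' s s' t X ee H IH]; first by left.
move=> /has_types_consE[He /IH{}IH] i.
have [sz sz'] := eq_exprs_size H; rewrite -sz in sz'.
(* The head of a substitution has the largest index, [size s]; beyond it both sides are the same
   outer variable. *)
rewrite -cat1s -(cat1s e'); case: (ltnP i (size s)) => [lt_i|le_i].
  by rewrite !inst_fun_cat_lt ?sz'; [exact: IH|exact: lt_i|].
rewrite -(subnKC le_i) inst_fun_cat -sz' inst_fun_cat.
case: (i - _) => [|j]; last by left; rewrite /inst_fun /= !nth_nil.
by right; exists t.
Qed.

(** Induction from the right: reversing the last equation turns its type from [inst sigma t] into
    [inst sigma' t]. These are equal by [eq_subst_expr], since [t] is a type over the earlier
    entries and [sigma] is typed. *)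
Lemma eq_exprs_sym Gamma sigma sigma' Xi :
  ctx_ok Xi -> has_types Gamma sigma Xi -> eq_exprs Gamma sigma sigma' Xi ->
  eq_exprs Gamma sigma' sigma Xi.
Proof.
elim/last_ind: Xi sigma sigma' => [|Xi t IH] sigma sigma'.
  move=> _ /has_types_size/size0nil-> H.
  have [_ /size0nil e] := eq_exprs_size H.
  by rewrite e in H *.
case/lastP: sigma => [|sigma e] /ctx_ok_rcons[okX tt] H.
  by have := has_types_size H; rewrite size_rcons.
case/lastP: sigma' => [|sigma' e'] E.
  by have [] := eq_exprs_size E; rewrite !size_rcons.
move: H E => /has_types_rcons[H He] /eq_exprs_rcons[E Ee].
apply/eq_exprs_rcons; split; first exact: IH.
apply: eqe_conv (eqe_sym Ee) _.
exact: eq_subst_expr (eq_exprs_funs E H) (has_type_inst tt H).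
Qed.

Definition indices_ok Xi rho Psi : Prop :=
  [/\ tel_scoped 0 Xi, all (scoped (size Xi)) rho & has_types Xi rho Psi].

(** Neither half mentions the variables of the other, so only the equation couples them, and the
    right-hand side is symmetric in the two halves up to the orientation of that equation. *)
Lemma unifier_catE Xi1 Xi2 rho1 rho2 Psi Gamma theta1 theta2 :
  tel_scoped 0 Xi2 -> all (scoped (size Xi2)) rho2 ->
  size theta1 = size Xi1 -> size theta2 = size Xi2 ->
  unifier Theta (Xi1 ++ Xi2) (map (shift (size Xi2)) rho1) rho2 Psi
    Gamma (theta1 ++ theta2) <->
  [/\ has_types Gamma theta1 Xi1, has_types Gamma theta2 Xi2
    & eq_exprs Gamma (insts theta1 rho1) (insts theta2 rho2) Psi].
Proof.
move=> cl2 sc2 sz1 sz2; rewrite /unifier has_types_cat // subst_tel_closed //.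
rewrite -sz2 insts_shift insts_cat_scoped ?sz2 //.
by split=> [[[]]|[]].
Qed.

Lemma unifier_swap Xi1 Xi2 rho1 rho2 Psi Gamma theta1 theta2 :
  tel_scoped 0 Psi -> ctx_ok Psi ->
  indices_ok Xi1 rho1 Psi -> indices_ok Xi2 rho2 Psi ->
  size theta1 = size Xi1 -> size theta2 = size Xi2 ->
  unifier Theta (Xi1 ++ Xi2) (map (shift (size Xi2)) rho1) rho2 Psi
    Gamma (theta1 ++ theta2) ->
  unifier Theta (Xi2 ++ Xi1) (map (shift (size Xi1)) rho2) rho1 Psi
    Gamma (theta2 ++ theta1).
Proof.
move=> clP okP [cl1 sc1 H1] [cl2 sc2 H2] sz1 sz2.
rewrite !unifier_catE // => -[th1 th2 E]; split=> //.
exact: eq_exprs_sym okP (has_types_inst H1 clP th1) E.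
Qed.

Lemma unifier_size Xi1 Xi2 rho1 rho2 Psi Gamma theta :
  unifier Theta (Xi1 ++ Xi2) rho1 rho2 Psi Gamma theta ->
  exists theta1 theta2,
    [/\ theta = theta1 ++ theta2, size theta1 = size Xi1
      & size theta2 = size Xi2].
Proof.
case=> /has_types_size; rewrite size_cat => sz _.
exists (take (size Xi1) theta), (drop (size Xi1) theta).
by rewrite cat_take_drop size_takel ?size_drop sz ?addKn ?leq_addr.
Qed.

(** The permuted mgu keeps its context [Gamma]. For generality a competing unifier is swapped back
    and factored there; the resulting equality over Xi_1; Xi_2 falls into two independent halves,
    since the telescopes are closed, and can be reassembled in the other order. *)
Lemma clause_ok_swap Xi1 Xi2 rho1 rho2 Psi t t' body :
  tel_scoped 0 Psi -> ctx_ok Psi ->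
  indices_ok Xi1 rho1 Psi -> indices_ok Xi2 rho2 Psi ->
  (forall theta1 theta2, size theta1 = size Xi1 -> size theta2 = size Xi2 ->
    inst (theta2 ++ theta1) t' = inst (theta1 ++ theta2) t) ->
  (forall e, body = Some e -> scoped (size Xi1 + size Xi2) e) ->
  clause_ok Theta (Xi1 ++ Xi2) (map (shift (size Xi2)) rho1) rho2 Psi t body ->
  clause_ok Theta (Xi2 ++ Xi1) (map (shift (size Xi1)) rho2) rho1 Psi t'
    (omap (swap (size Xi1) (size Xi2)) body).
Proof.
move=> clP okP ok1 ok2 tt'; case: body => [e|] /= sc.
  case=> Gamma [theta [[uni most] He]].
  have [theta1 [theta2 [eth sz1 sz2]]] := unifier_size uni.
  rewrite {}eth in uni most He.
  exists Gamma, (theta2 ++ theta1); split; last first.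
    rewrite tt' // -sz1 -sz2 inst_swap // sz1 sz2; exact: sc.
  split=> [|Gamma' theta' uni']; first exact: unifier_swap uni.
  have [s2 [s1 [eth' ss2 ss1]]] := unifier_size uni'; rewrite {}eth' in uni' *.
  have [tau [Htau E]] := most _ _ (unifier_swap clP okP ok2 ok1 ss2 ss1 uni').
  exists tau; split=> //; have [[cl1 _ _] [cl2 _ _]] := (ok1, ok2).
  move: E; rewrite /insts !map_cat !eq_exprs_cat ?size_map //.
  by rewrite !subst_tel_closed // => -[].
move=> nuni [Gamma [theta uni]]; apply: nuni.
have [s2 [s1 [eth ss2 ss1]]] := unifier_size uni; rewrite {}eth in uni *.
by exists Gamma, (s1 ++ s2); exact: unifier_swap uni.
Qed.

End Metatheory.

(** * Cases of definitions against cocases of codefinitions *)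

Section Clauses.

Context {TN CN DN : eqType}.
Implicit Types (Theta : seq (decl TN CN DN)) (c : psig TN CN DN)
  (d : csig TN CN DN) (s : seq (expr TN CN DN)).

(** The type t[C id/z] of a clause body, here with the telescope of [d] before that of [c], in
    [cocase_type] the other way round. *)
Definition case_type c d :=
  inst (rcons (ids (size (p_tel c)) (size (c_tel d)))
         (Pro (p_name c) (ids 0 (size (p_tel c))))) (c_type d).

Definition cocase_type c d :=
  inst (rcons (ids 0 (size (c_tel d)))
         (Pro (p_name c) (ids (size (c_tel d)) (size (p_tel c))))) (c_type d).

Definition case_ok Theta Psi c d body : Prop :=
  clause_ok Theta (c_tel d ++ p_tel c)
    (map (shift (size (p_tel c))) (c_ix d)) (p_ix c) Psi (case_type c d) body.

Definition cocase_ok Theta Psi c d body : Prop :=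
  clause_ok Theta (p_tel c ++ c_tel d)
    (map (shift (size (c_tel d))) (p_ix c)) (c_ix d) Psi (cocase_type c d) body.

(** Either clause type becomes, on instantiation, the type that the computation rules give to the
    redex; this is the agreement that [clause_ok_swap] asks for. *)
Lemma inst_case_type c d s1 s2 : csig_scoped d ->
  size s1 = size (p_tel c) -> size s2 = size (c_tel d) ->
  inst (s2 ++ s1) (case_type c d) =
  inst (rcons s2 (Pro (p_name c) s1)) (c_type d).
Proof.
case/and3P=> _ _ sc sz1 sz2.
rewrite {1}/inst subst_inst ?size_rcons ?size_ids // map_rcons.
congr (inst (rcons _ (Pro _ _)) _).
  by rewrite -sz1 -sz2; exact: (insts_ids [::]).
by have := insts_ids s2 s1 [::]; rewrite cats0 sz1.
Qed.

Lemma inst_cocase_type c d s1 s2 : csig_scoped d ->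
  size s1 = size (p_tel c) -> size s2 = size (c_tel d) ->
  inst (s1 ++ s2) (cocase_type c d) =
  inst (rcons s2 (Pro (p_name c) s1)) (c_type d).
Proof.
case/and3P=> _ _ sc sz1 sz2.
rewrite {1}/inst subst_inst ?size_rcons ?size_ids // map_rcons.
congr (inst (rcons _ (Pro _ _)) _).
  by have := insts_ids s1 s2 [::]; rewrite cats0 sz2.
by rewrite -sz1 -sz2; exact: (insts_ids [::]).
Qed.

Variable Theta : seq (decl TN CN DN).
Hypothesis Theta_valid : valid Theta.
Variables (Psi : seq (expr TN CN DN)) (c : psig TN CN DN) (d : csig TN CN DN).
Hypotheses (Psi_scoped : tel_scoped 0 Psi) (Psi_ok : ctx_ok Theta Psi).
Hypotheses (c_scoped : psig_scoped c) (d_scoped : csig_scoped d).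
Hypothesis c_ok : has_types Theta (p_tel c) (p_ix c) Psi.
Hypothesis d_ok : has_types Theta (c_tel d) (c_ix d) Psi.

Lemma case_cocase body :
  (forall e, body = Some e -> scoped (size (c_tel d) + size (p_tel c)) e) ->
  case_ok Theta Psi c d body ->
  cocase_ok Theta Psi c d (omap (swap (size (c_tel d)) (size (p_tel c))) body).
Proof.
have [[cl1 sc1] [cl2 sc2 _]] := (andP c_scoped, and3P d_scoped).
move=> sc; apply: clause_ok_swap => // s2 s1 sz2 sz1.
by rewrite inst_case_type // inst_cocase_type.
Qed.

Lemma cocase_case body :
  (forall e, body = Some e -> scoped (size (p_tel c) + size (c_tel d)) e) ->
  cocase_ok Theta Psi c d body ->
  case_ok Theta Psi c d (omap (swap (size (p_tel c)) (size (c_tel d))) body).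
Proof.
have [[cl1 sc1] [cl2 sc2 _]] := (andP c_scoped, and3P d_scoped).
move=> sc; apply: clause_ok_swap => // s1 s2 sz1 sz2.
by rewrite inst_case_type // inst_cocase_type.
Qed.

End Clauses.

(** * Invariance of the judgments under exchanging data and codata *)

Section Simulation.

Context {TN CN DN : eqType}.
Implicit Types (Theta : seq (decl TN CN DN)) (c : psig TN CN DN)
  (d : csig TN CN DN).

(** Both computation rules in one relation, with contractum [r]: the transformations exchange the
    two alternatives at [T], and only the disjunction is invariant. *)
Definition computes Theta T Psi c d sigma1 sigma2 r : Prop :=
  (exists cs cases e,
    [/\ In (Data T Psi cs) Theta, In c cs, In (Def T d cases) Theta,
        In (p_name c, Some e) cases & r = inst (sigma2 ++ sigma1) e]) \/
  (exists ds cocases e,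
    [/\ In (Codata T Psi ds) Theta, In d ds, In (Codef T c cocases) Theta,
        In (c_name d, Some e) cocases & r = inst (sigma1 ++ sigma2) e]).

Lemma eqe_computes Theta Gamma T Psi c d sigma1 sigma2 r :
  computes Theta T Psi c d sigma1 sigma2 r ->
  has_types Theta Gamma sigma1 (p_tel c) ->
  has_types Theta Gamma sigma2 (c_tel d) ->
  eq_exprs Theta Gamma (insts sigma1 (p_ix c)) (insts sigma2 (c_ix d)) Psi ->
  eq_expr Theta Gamma (Con (Pro (p_name c) sigma1) (c_name d) sigma2) r
    (inst (rcons sigma2 (Pro (p_name c) sigma1)) (c_type d)).
Proof.
case=> [[cs [ms [e [dT cc dd ec ->]]]]|[ds [os [e [dT dd cc ec ->]]]]].
  exact: eqe_data dT cc dd ec.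
exact: eqe_codata dT dd cc ec.
Qed.

(** All that the judgments consult of a program. Contraction is compared at substitutions of the
    right lengths only, where re-indexing a body is correct; typed substitutions have these
    lengths. *)
Definition simulates Theta Theta' : Prop :=
  [/\ forall T Psi, is_type Theta T Psi -> is_type Theta' T Psi,
      forall T c, is_producer Theta T c -> is_producer Theta' T c,
      forall T d, is_consumer Theta T d -> is_consumer Theta' T d
    & forall T Psi c d sigma1 sigma2 r,
        size sigma1 = size (p_tel c) -> size sigma2 = size (c_tel d) ->
        computes Theta T Psi c d sigma1 sigma2 r ->
        computes Theta' T Psi c d sigma1 sigma2 r].

Lemma simulates_judgments Theta Theta' : simulates Theta Theta' ->
  (forall Gamma, ctx_ok Theta Gamma -> ctx_ok Theta' Gamma) /\
  (forall Gamma Xi, tel_ok Theta Gamma Xi -> tel_ok Theta' Gamma Xi) /\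
  (forall Gamma sigma Xi,
    has_types Theta Gamma sigma Xi -> has_types Theta' Gamma sigma Xi) /\
  (forall Gamma sigma sigma' Xi, eq_exprs Theta Gamma sigma sigma' Xi ->
    eq_exprs Theta' Gamma sigma sigma' Xi) /\
  (forall Gamma e t, has_type Theta Gamma e t -> has_type Theta' Gamma e t) /\
  (forall Gamma e e' t,
    eq_expr Theta Gamma e e' t -> eq_expr Theta' Gamma e e' t).
Proof.
case=> st sp sc sr; apply: judgments_mutind.
- exact: ctx_nil.
- by move=> *; apply: ctx_rcons.
- by move=> *; apply: tel_nil.
- by move=> *; apply: tel_cons.
- by move=> *; apply: types_nil.
- by move=> *; apply: types_cons.
- by move=> *; apply: eqs_nil.
- by move=> *; apply: eqs_cons.
- by move=> *; apply: type_var.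
- by move=> *; apply: type_typ.
- by move=> G e t t' _ H _; exact: type_conv.
- by move=> G T Psi rho /st tT _; exact: type_tycon.
- by move=> G T s sigma /sp ps _; exact: type_pro.
- by move=> G T s e sigma /sc cs _ H _; exact: type_con.
- by move=> *; apply: eqe_refl.
- by move=> *; apply: eqe_sym.
- by move=> G e e' e'' t _ H _; exact: eqe_trans.
- by move=> G e e' t t' _ H _; exact: eqe_conv.
- by move=> G T Psi rho rho' /st tT _; exact: eqe_tycon.
- by move=> G T s sigma sigma' /sp ps _; exact: eqe_pro.
- by move=> G T s e e' sigma sigma' /sc cs _ H _; exact: eqe_con.
- move=> G T Psi cs c d ms e s1 s2 dT cc dd ec /has_types_size sz1 H1
    /has_types_size sz2 H2 _ H; apply: (eqe_computes (T := T)) H1 H2 H.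
  by apply: sr => //; left; exists cs, ms, e.
- move=> G T Psi ds c d os e s1 s2 dT dd cc ec /has_types_size sz1 H1
    /has_types_size sz2 H2 _ H; apply: (eqe_computes (T := T)) H1 H2 H.
  by apply: sr => //; right; exists ds, os, e.
Qed.

Lemma unifier_sim Theta Theta' Delta rho1 rho2 Psi Gamma theta :
  simulates Theta Theta' ->
  unifier Theta Delta rho1 rho2 Psi Gamma theta ->
  unifier Theta' Delta rho1 rho2 Psi Gamma theta.
Proof.
by move/simulates_judgments => [_ [_ [H1 [H2 _]]]] [/H1 ? /H2 ?].
Qed.

(** Unifiers occur negatively in the generality of an mgu and in absurd clauses, hence the
    simulation in both directions. *)
Lemma clause_ok_sim Theta Theta' Delta rho1 rho2 Psi t body :
  simulates Theta Theta' -> simulates Theta' Theta ->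
  clause_ok Theta Delta rho1 rho2 Psi t body ->
  clause_ok Theta' Delta rho1 rho2 Psi t body.
Proof.
move=> sim sim'; case: body => [e|] /=; last first.
  move=> nuni [Gamma [theta /(unifier_sim sim') uni]].
  by apply: nuni; exists Gamma, theta.
have [_ [_ [H1 [H2 [H3 _]]]]] := simulates_judgments sim.
case=> Gamma [theta [[uni most] /H3 He]]; exists Gamma, theta; split=> //.
split; first exact: unifier_sim uni.
move=> Gamma' theta' /(unifier_sim sim')/most[tau [/H1 ? /H2 ?]].
by exists tau.
Qed.

Definition decl_type (delta : decl TN CN DN) : TN :=
  match delta with
  | Data T _ _ | Def T _ _ | Codata T _ _ | Codef T _ _ => T
  end.

(** A definition or codefinition for a type other than [T] refers to the declaration of that same
    type, which is kept as it is. *)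
Lemma decl_ok_sim Theta Theta' T delta :
  simulates Theta Theta' -> simulates Theta' Theta ->
  (forall delta', decl_type delta' != T ->
    In delta' Theta -> In delta' Theta') ->
  decl_type delta != T -> decl_ok Theta delta -> decl_ok Theta' delta.
Proof.
move=> sim sim' other.
have [_ [H0 [H1 [_ [H2 _]]]]] := simulates_judgments sim.
case: delta => [T' Psi cs|T' d ms|T' Psi ds|T' c os] /= neT.
- by move=> [/H0 ? H]; split=> // c /H[/H0 ? /H1 ?].
- move=> [Psi [cs [dT /H1 ? /H2 ? H]]]; exists Psi, cs; split=> //.
    exact: other.
  by move=> c body cc /(H _ _ cc); exact: clause_ok_sim.
- by move=> [/H0 ? H]; split=> // d /H[/H0 ? /H1 ? /H2 ?].
- move=> [Psi [ds [dT /H1 ? H]]]; exists Psi, ds; split=> //.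
    exact: other.
  by move=> d body dd /(H _ _ dd); exact: clause_ok_sim.
Qed.

Lemma Data_no_Codef Theta T Psi cs c os : valid Theta ->
  In (Data T Psi cs) Theta -> In (Codef T c os) Theta -> False.
Proof.
move=> vT dT; have [_ _ _ H] := vT => /H[_ [Psi' [ds [dT' _ _]]]].
exact: (Data_Codata vT dT dT').
Qed.

Lemma Codata_no_Def Theta T Psi ds d ms : valid Theta ->
  In (Codata T Psi ds) Theta -> In (Def T d ms) Theta -> False.
Proof.
move=> vT dT; have [_ _ _ H] := vT => /H[_ [Psi' [cs [dT' _ _]]]].
exact: (Data_Codata vT dT' dT).
Qed.

(** The clause matrix at [T], read by rows in [Theta_d] and by columns in [Theta_c]. Only membership
    is recorded, as the order of declarations and of clauses does not affect the judgments. *)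
Record dual T Psi cs ds (Theta_d Theta_c : seq (decl TN CN DN)) : Prop := Dual {
  dual_data : In (Data T Psi cs) Theta_d;
  dual_codata : In (Codata T Psi ds) Theta_c;
  dual_codefs : forall c, In c cs <-> exists os, In (Codef T c os) Theta_c;
  dual_defs : forall d, In d ds <-> exists ms, In (Def T d ms) Theta_d;
  dual_cocase : forall c d ms os body,
    In (Def T d ms) Theta_d -> In (Codef T c os) Theta_c ->
    In (p_name c, body) ms ->
    In (c_name d, omap (swap (size (c_tel d)) (size (p_tel c))) body) os;
  dual_case : forall c d ms os body,
    In (Def T d ms) Theta_d -> In (Codef T c os) Theta_c ->
    In (c_name d, body) os ->
    In (p_name c, omap (swap (size (p_tel c)) (size (c_tel d))) body) ms;
  dual_other : forall delta, decl_type delta != T ->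
    In delta Theta_d <-> In delta Theta_c }.

Section Duality.

Variables (Theta_d Theta_c : seq (decl TN CN DN)).
Variables (T : TN) (Psi : seq (expr TN CN DN)).
Variables (cs : seq (psig TN CN DN)) (ds : seq (csig TN CN DN)).
Hypotheses (valid_d : valid Theta_d) (valid_c : valid Theta_c).
Hypothesis D : dual T Psi cs ds Theta_d Theta_c.

Let data := dual_data D.
Let codata := dual_codata D.

Lemma to_codata delta :
  decl_type delta != T -> In delta Theta_d -> In delta Theta_c.
Proof. by move=> /(dual_other D)[]. Qed.

Lemma to_data delta :
  decl_type delta != T -> In delta Theta_c -> In delta Theta_d.
Proof. by move=> /(dual_other D)[]. Qed.

Lemma simulates_dc : simulates Theta_d Theta_c.
Proof.
split.
- move=> T' Psi'; case: (eqVneq T' T) => [->|neT].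
    case=> [[cs' dT]|[ds' dT]]; last by case: (Data_Codata valid_d data dT).
    by have [<- _] := Data_inj valid_d data dT; right; exists ds.
  by case=> [[cs' /to_codata dT]|[ds' /to_codata dT]];
    [left; exists cs'|right; exists ds']; exact: dT.
- move=> T' c; case: (eqVneq T' T) => [->|neT].
    case=> [[Psi' [cs' [dT cc]]]|[os /(Data_no_Codef valid_d data)//]].
    have [_ e] := Data_inj valid_d data dT; right.
    by apply/(dual_codefs D); rewrite e.
  by case=> [[Psi' [cs' [/to_codata dT cc]]]|[os /to_codata dT]];
    [left; exists Psi', cs'; split=> //|right; exists os]; exact: dT.
- move=> T' d; case: (eqVneq T' T) => [->|neT].
    case=> [H|[Psi' [ds' [/(Data_Codata valid_d data)//]]]].
    by right; exists Psi, ds; split=> //; apply/(dual_defs D).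
  by case=> [[ms /to_codata dT]|[Psi' [ds' [/to_codata dT dd]]]];
    [left; exists ms|right; exists Psi', ds'; split=> //]; exact: dT.
- move=> T' Psi' c d s1 s2 r sz1 sz2; case: (eqVneq T' T) => [->|neT].
    case=> [[cs' [ms [e [dT cc dd ec ->]]]]|[ds' [os [e [dT]]]]]; last first.
      by case: (Data_Codata valid_d data dT).
    have se := case_scoped valid_d dT cc dd ec.
    have [<- ecs] := Data_inj valid_d data dT; rewrite -{}ecs in cc.
    have [os cT] := (dual_codefs D c).1 cc.
    (* The other rule contracts with the re-indexed body; by [inst_swap] the contractum is literally
       the same expression. *)
    right; exists ds, os, (swap (size (c_tel d)) (size (p_tel c)) e).
    split=> //.
    + by apply/(dual_defs D); exists ms.
    + exact: (dual_cocase D dd cT ec).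
    + by rewrite -sz1 -sz2 inst_swap // sz1 sz2.
  case=> [[cs' [ms [e [/to_codata dT cc /to_codata dd ec ->]]]]|].
    by left; exists cs', ms, e; split=> //; [exact: dT|exact: dd].
  case=> [ds' [os [e [/to_codata dT dd /to_codata cc ec ->]]]].
  by right; exists ds', os, e; split=> //; [exact: dT|exact: cc].
Qed.

Lemma simulates_cd : simulates Theta_c Theta_d.
Proof.
split.
- move=> T' Psi'; case: (eqVneq T' T) => [->|neT].
    case=> [[cs' dT]|[ds' dT]]; first by case: (Data_Codata valid_c dT codata).
    by have [<- _] := Codata_inj valid_c codata dT; left; exists cs.
  by case=> [[cs' /to_data dT]|[ds' /to_data dT]];
    [left; exists cs'|right; exists ds']; exact: dT.
- move=> T' c; case: (eqVneq T' T) => [->|neT].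
    case=> [[Psi' [cs' [dT _]]]|H].
      by case: (Data_Codata valid_c dT codata).
    by left; exists Psi, cs; split=> //; apply/(dual_codefs D).
  by case=> [[Psi' [cs' [/to_data dT cc]]]|[os /to_data dT]];
    [left; exists Psi', cs'; split=> //|right; exists os]; exact: dT.
- move=> T' d; case: (eqVneq T' T) => [->|neT].
    case=> [[ms /(Codata_no_Def valid_c codata)//]|[Psi' [ds' [dT dd]]]].
    have [_ e] := Codata_inj valid_c codata dT; left.
    by apply/(dual_defs D); rewrite e.
  by case=> [[ms /to_data dT]|[Psi' [ds' [/to_data dT dd]]]];
    [left; exists ms|right; exists Psi', ds'; split=> //]; exact: dT.
- move=> T' Psi' c d s1 s2 r sz1 sz2; case: (eqVneq T' T) => [->|neT].
    case=> [[cs' [ms [e [dT]]]]|[ds' [os [e [dT dd cc ec ->]]]]].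
      by case: (Data_Codata valid_c dT codata).
    have se := cocase_scoped valid_c dT dd cc ec.
    have [<- eds] := Codata_inj valid_c codata dT; rewrite -{}eds in dd.
    have [ms dT'] := (dual_defs D d).1 dd.
    left; exists cs, ms, (swap (size (p_tel c)) (size (c_tel d)) e); split=> //.
    + by apply/(dual_codefs D); exists os.
    + exact: (dual_case D dT' cc ec).
    + by rewrite -sz1 -sz2 inst_swap // sz1 sz2.
  case=> [[cs' [ms [e [/to_data dT cc /to_data dd ec ->]]]]|].
    by left; exists cs', ms, e; split=> //; [exact: dT|exact: dd].
  case=> [ds' [os [e [/to_data dT dd /to_data cc ec ->]]]].
  by right; exists ds', os, e; split=> //; [exact: dT|exact: cc].
Qed.

Lemma omap_swapK n1 n2 (body : option (expr TN CN DN)) :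
  (forall e, body = Some e -> scoped (n1 + n2) e) ->
  omap (swap n2 n1) (omap (swap n1 n2) body) = body.
Proof. by case: body => //= e sc; rewrite swapK //; exact: sc. Qed.

Lemma omap_swap_scoped n1 n2 (body : option (expr TN CN DN)) :
  (forall e, body = Some e -> scoped (n1 + n2) e) ->
  forall e, omap (swap n1 n2) body = Some e -> scoped (n2 + n1) e.
Proof.
by case: body => //= e sc e' [<-]; apply: scoped_swap; exact: sc.
Qed.

Lemma well_formed_dc : well_formed Theta_d -> well_formed Theta_c.
Proof.
have [_ [H0 [H1 [_ [H2 _]]]]] := simulates_judgments simulates_dc.
move=> wf; have [/= Psi_ok cs_ok] := wf _ data.
have def_ok d ms : In (Def T d ms) Theta_d ->
    [/\ has_types Theta_d (c_tel d) (c_ix d) Psi,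
        has_type Theta_d (rcons (c_tel d) (TyCon T (c_ix d))) (c_type d) Typ
      & forall c body, In c cs -> In (p_name c, body) ms ->
          case_ok Theta_d Psi c d body].
  move=> /wf[Psi' [cs' [dT]]].
  by have [<- <-] := Data_inj valid_d data dT.
move=> delta dT; case: (eqVneq (decl_type delta) T); last first.
  move=> neT; apply: (decl_ok_sim simulates_dc simulates_cd to_codata neT).
  by apply: wf; exact: to_data.
case: delta dT => [T' Psi' cs'|T' d ms|T' Psi' ds'|T' c os] dT /= eT;
  rewrite {}eT in dT *.
- by case: (Data_Codata valid_c dT codata).
- by case: (Codata_no_Def valid_c codata dT).
- have [<- <-] := Codata_inj valid_c codata dT; split; first exact: H0.
  move=> d /(dual_defs D)[ms /def_ok[d_ok t_ok _]].
  split; [apply: H0|exact: H1|exact: H2].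
  (* A destructor must have a well-formed telescope while a definition is not asked for one; it is
     recovered as the context in which the indices are typed. *)
  by apply: ctx_ok_tel; exact: has_types_ctx d_ok.
- exists Psi, ds; have cc : In c cs by apply/(dual_codefs D); exists os.
  have [_ c_ok] := cs_ok c cc.
  split=> //; first exact: H1.
  move=> d body dd db; have [ms dT'] := (dual_defs D d).1 dd.
  have [d_ok _ clauses] := def_ok _ _ dT'.
  have sc e : body = Some e -> scoped (size (p_tel c) + size (c_tel d)) e.
    move=> eb; rewrite eb in db.
    exact: (cocase_scoped valid_c codata dd dT db).
  (* This moves the goal to [Theta_d], where the typings of the indices are given and the telescopes
     can be exchanged. *)
  apply: (clause_ok_sim simulates_dc simulates_cd).
  have := clauses _ _ cc (dual_case D dT' dT db).
  (* The cocase body is written as the re-indexing of its own re-indexing, which is the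
     corresponding case body. *)
  rewrite -{2}(omap_swapK sc); apply: case_cocase => //.
  + by apply: (is_type_scoped valid_d (T := T)); left; exists cs.
  + exact: tel_ok_ctx Psi_ok.
  + by apply: (is_producer_scoped valid_d (T := T)); left; exists Psi, cs.
  + by apply: (is_consumer_scoped valid_d (T := T)); left; exists ms.
  + exact: omap_swap_scoped.
Qed.

Lemma well_formed_cd : well_formed Theta_c -> well_formed Theta_d.
Proof.
have [_ [H0 [H1 [_ [H2 _]]]]] := simulates_judgments simulates_cd.
move=> wf; have [/= Psi_ok ds_ok] := wf _ codata.
have codef_ok c os : In (Codef T c os) Theta_c ->
    has_types Theta_c (p_tel c) (p_ix c) Psi /\
    forall d body, In d ds -> In (c_name d, body) os ->
      cocase_ok Theta_c Psi c d body.
  move=> /wf[Psi' [ds' [dT]]].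
  by have [<- <-] := Codata_inj valid_c codata dT.
move=> delta dT; case: (eqVneq (decl_type delta) T); last first.
  move=> neT; apply: (decl_ok_sim simulates_cd simulates_dc to_data neT).
  by apply: wf; exact: to_codata.
case: delta dT => [T' Psi' cs'|T' d ms|T' Psi' ds'|T' c os] dT /= eT;
  rewrite {}eT in dT *.
- have [<- <-] := Data_inj valid_d data dT; split; first exact: H0.
  move=> c /(dual_codefs D)[os /codef_ok[c_ok _]].
  split; [apply: H0|exact: H1].
  by apply: ctx_ok_tel; exact: has_types_ctx c_ok.
- exists Psi, cs; have dd : In d ds by apply/(dual_defs D); exists ms.
  have [_ d_ok t_ok] := ds_ok d dd.
  split=> //; [exact: H1|exact: H2|].
  move=> c body cc cb; have [os cT] := (dual_codefs D c).1 cc.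
  have [c_ok clauses] := codef_ok _ _ cT.
  have sc e : body = Some e -> scoped (size (c_tel d) + size (p_tel c)) e.
    move=> eb; rewrite eb in cb.
    exact: (case_scoped valid_d data cc dT cb).
  apply: (clause_ok_sim simulates_cd simulates_dc).
  have := clauses _ _ dd (dual_cocase D dT cT cb).
  rewrite -{2}(omap_swapK sc); apply: cocase_case => //.
  + by apply: (is_type_scoped valid_c (T := T)); right; exists ds.
  + exact: tel_ok_ctx Psi_ok.
  + by apply: (is_producer_scoped valid_c (T := T)); right; exists os.
  + by apply: (is_consumer_scoped valid_c (T := T)); right; exists Psi, ds.
  + exact: omap_swap_scoped.
- by case: (Data_Codata valid_d data dT).
- by case: (Data_no_Codef valid_d data dT).
Qed.

End Duality.

End Simulation.

(** * Both transformations produce dual programs *)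

Section Transformations.

Context {TN CN DN : eqType}.
Variables (Theta : seq (decl TN CN DN)) (T : TN).
Hypothesis Theta_valid : valid Theta.

Lemma In_cases_from (d : csig TN CN DN) K C body :
  In (C, body) (cases_from d K) <->
  exists (c : psig TN CN DN) os b, [/\ In (c, os) K, In (c_name d, b) os,
    C = p_name c & body = omap (swap (size (p_tel c)) (size (c_tel d))) b].
Proof.
split=> [/In_flatten[[c os] [kK /In_map[[D b] [[<- <-]]]]]|].
  by move=> /List.filter_In[ab /eqP /= eD]; exists c, os, b; rewrite -eD.
case=> c [os [b [kK ab -> ->]]]; apply/In_flatten; exists (c, os); split=> //.
apply/In_map; exists (c_name d, b); split=> //.
by apply/List.filter_In; rewrite /= eqxx.
Qed.

Lemma In_cocases_from (c : psig TN CN DN) K D body :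
  In (D, body) (cocases_from c K) <->
  exists (d : csig TN CN DN) ms b, [/\ In (d, ms) K, In (p_name c, b) ms,
    D = c_name d & body = omap (swap (size (c_tel d)) (size (p_tel c))) b].
Proof.
split=> [/In_flatten[[d ms] [kK /In_map[[C b] [[<- <-]]]]]|].
  by move=> /List.filter_In[ab /eqP /= eC]; exists d, ms, b; rewrite -eC.
case=> d [ms [b [kK ab -> ->]]]; apply/In_flatten; exists (d, ms); split=> //.
apply/In_map; exists (p_name c, b); split=> //.
by apply/List.filter_In; rewrite /= eqxx.
Qed.

Lemma Codef_inj c c' os os' : In (Codef T c os) Theta ->
  In (Codef T c' os') Theta -> p_name c = p_name c' -> c = c' /\ os = os'.
Proof.
have [_ up_ _ _] := Theta_valid => dT dT' ec.
have := uniq_flatten_inj up_ (z := p_name c) dT dT'.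
by rewrite /= !inE -ec eqxx => /(_ isT isT)[].
Qed.

Lemma Def_inj d d' ms ms' : In (Def T d ms) Theta ->
  In (Def T d' ms') Theta -> c_name d = c_name d' -> d = d' /\ ms = ms'.
Proof.
have [_ _ uc _] := Theta_valid => dT dT' ed.
have := uniq_flatten_inj uc (z := c_name d) dT dT'.
by rewrite /= !inE -ed eqxx => /(_ isT isT)[].
Qed.

(** Cocases become cases by construction. Conversely, a case under the name of [c] stems from the
    codefinition [c] itself, by uniqueness of names, and scoping of the original cocase allows its
    re-indexing to be undone. *)
Lemma dual_defunc Psi ds : In (Codata T Psi ds) Theta ->
  dual T Psi (map fst (codefs_of T Theta)) ds (defunc_decls T Theta) Theta.
Proof.
move=> dT.
have defE d ms : In (Def T d ms) (defunc_decls T Theta) <->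
    In d ds /\ ms = cases_from d (codefs_of T Theta).
  split=> [/In_defunc[[? [? [_ //]]]|[Psi' [ds' [d' [dT' dd [-> ->]]]]]|]|].
  - by have [_ <-] := Codata_inj Theta_valid dT' dT.
  - by case=> /(Codata_no_Def Theta_valid dT).
  - by case=> dd ->; apply/In_defunc; constructor 2; exists Psi, ds, d.
split=> //.
- by apply/In_defunc; constructor 1; exists Psi, ds.
- move=> c; split=> [/In_map[[c' os] [/= <- /In_codefs]]|[os /= cT]].
    by exists os.
  by apply/In_map; exists (c, os); split=> //; apply/In_codefs.
- move=> d; split=> [dd|[ms /defE[]//]].
  by exists (cases_from d (codefs_of T Theta)); apply/defE.
- move=> c d ms os body /defE[dd ->] cT.
  case/In_cases_from=> c' [os' [b [/In_codefs cT' db ec ->]]].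
  have [/= <- eos] := Codef_inj cT cT' ec; rewrite -{}eos in db.
  rewrite omap_swapK // => e eb; rewrite eb in db.
  exact: (cocase_scoped Theta_valid dT dd cT db).
- move=> c d ms os body /defE[dd ->] cT db; apply/In_cases_from.
  by exists c, os, body; split=> //; apply/In_codefs.
- move=> delta neT.
  split=> [/In_defunc[[? [? [_ e]]]|[? [? [? [_ _ e]]]]|[]//]|].
  + by rewrite e eqxx in neT.
  + by rewrite e eqxx in neT.
  + move=> dT'; apply/In_defunc; constructor 3.
    by split=> // ? ? e; rewrite e eqxx in neT.
Qed.

Lemma dual_refunc Psi cs : In (Data T Psi cs) Theta ->
  dual T Psi cs (map fst (defs_of T Theta)) Theta (refunc_decls T Theta).
Proof.
move=> dT.
have codefE c os : In (Codef T c os) (refunc_decls T Theta) <->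
    In c cs /\ os = cocases_from c (defs_of T Theta).
  split=> [/In_refunc[[? [? [_ //]]]|[Psi' [cs' [c' [dT' cc [-> ->]]]]]|]|].
  - by have [_ <-] := Data_inj Theta_valid dT' dT.
  - by case=> /(Data_no_Codef Theta_valid dT).
  - by case=> cc ->; apply/In_refunc; constructor 2; exists Psi, cs, c.
split=> //.
- by apply/In_refunc; constructor 1; exists Psi, cs.
- move=> c; split=> [cc|[os /codefE[]//]].
  by exists (cocases_from c (defs_of T Theta)); apply/codefE.
- move=> d; split=> [/In_map[[d' ms] [/= <- /In_defs]]|[ms /= dd]].
    by exists ms.
  by apply/In_map; exists (d, ms); split=> //; apply/In_defs.
- move=> c d ms os body dd /codefE[cc ->] cb; apply/In_cocases_from.
  by exists d, ms, body; split=> //; apply/In_defs.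
- move=> c d ms os body dd /codefE[cc ->].
  case/In_cocases_from=> d' [ms' [b [/In_defs dd' cb ed ->]]].
  have [/= <- ems] := Def_inj dd dd' ed; rewrite -{}ems in cb.
  rewrite omap_swapK // => e eb; rewrite eb in cb.
  exact: (case_scoped Theta_valid dT cc dd cb).
- move=> delta neT; split=> [dT'|].
    apply/In_refunc; constructor 3.
    by split=> // ? ? e; rewrite e eqxx in neT.
  case/In_refunc=> [[? [? [_ e]]]|[? [? [? [_ _ e]]]]|[]//].
  + by rewrite e eqxx in neT.
  + by rewrite e eqxx in neT.
Qed.

End Transformations.

Theorem theorem6p4 (TN CN DN : eqType) (Theta : program TN CN DN) (T : TN)
    (declared : T \in type_names Theta) (wf : well_formed Theta) :
  well_formed (transform T Theta).
Proof.
have vT := program_valid Theta; rewrite /transform.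
case: ifPn => [hc|nc] /=.
  have [Psi [ds dT]] : exists Psi ds, In (Codata T Psi ds) Theta.
    elim: (decls Theta) hc => //= delta Th IH.
    case/orP=> [|/IH[Psi [ds ?]]]; last first.
      by exists Psi, ds; right.
    by case: delta => // T' Psi ds /eqP ->; exists Psi, ds; left.
  exact: (well_formed_cd (valid_defunc T vT) vT (dual_defunc vT dT)).
(* Only data and codata declarations contribute type names, and the codata case is excluded by
   [nc]. *)
have [Psi [cs dT]] : exists Psi cs, In (Data T Psi cs) Theta.
  move: declared => /In_mem/In_flatten.
  case=> [[T' Psi cs|T' d ms|T' Psi ds|T' c os]] [].
  - by move=> dT [<-|//]; exists Psi, cs.
  - by [].
  - move=> dT [eT|//]; case/negP: nc; elim: (decls Theta) dT => //= x Th IH.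
    by case=> [->|/IH ->]; rewrite ?orbT //= eT eqxx.
  - by [].
exact: (well_formed_dc vT (valid_refunc T vT) (dual_refunc vT dT)).
Qed.
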